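(* Let $E\subseteq[n]\times[m]$ be the set of edges of a $(d_1,d_2)$-regular bipartite graph whose adjacency matrix has second largest eigenvalue at most $\eta$. For every $Y\in\mathbb{R}^{n\times m}$, if $\hat Y$ is the output of (i.e. a solution to) the optimization problem \[ \text{minimize } \gamma_2(X)\ \text{ over } X\in\mathbb{R}^{n\times m}\quad\text{subject to } X_{ij}=Y_{ij}\ \text{ for all }(i,j)\in E, \] then \[ \frac{1}{nm}\|\hat Y-Y\|_F^2\le c\,\gamma_2(Y)^2\,\frac{\eta}{\sqrt{d_1d_2}}, \] where $c=4K_G\le 7.13$.
   Context: A $(d_1,d_2)$-regular (bipartite, biregular) graph is a simple bipartite graph with vertex set $V_1\cup V_2$, $V_1=[n]$, $V_2=[m]$, all edges between $V_1$ and $V_2$, each vertex of $V_i$ having degree $d_i$ (so $nd_1=md_2=|E|$); an edge between $i\in V_1$ and $j\in V_2$ is recorded as $(i,j)\in E$. The second largest eigenvalue is the second entry in the decreasing list, with multiplicity, of the eigenvalues of the $(n+m)\times(n+m)$ adjacency matrix (the largest being $\sqrt{d_1d_2}$). For a real matrix $Y$, $\gamma_2(Y)=\min_{UV^*=Y}\max_{i,j}\|u_i\|_2\|v_j\|_2$, where the minimum is over all factorizations $Y=UV^*$ and $u_i$, $v_j$ are the rows of $U$ and $V$. $\|\cdot\|_F$ is the Frobenius norm. $K_G$ is the (real) Grothendieck constant, a universal constant with $\gamma_2(X)\le\nu(X)\le K_G\gamma_2(X)$ for every real matrix $X$, where $\nu(X)$ is the sign nuclear norm: the minimum of $\sum_i|\alpha_i|$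 over decompositions $X=\sum_i\alpha_iS^i$ with $\alpha_i\in\mathbb{R}$ and $S^i$ rank-one matrices with entries in $\{-1,1\}$.
   Formalization: The formal statement also assumes η ≥ 0; this is automatic unless n=m=1 with the single-edge graph, where the second eigenvalue is −1 and, for −1 ≤ η < 0 and Y ≠ 0, the claimed bound fails (left side 0, right side negative). *)

(* Defs.v *)
From HB Require Import structures.
From mathcomp Require Import all_boot all_order all_algebra.
From mathcomp Require Import mathcomp_extra boolp classical_sets reals.

Set Implicit Arguments.
Unset Strict Implicit.
Unset Printing Implicit Defensive.

Import Order.TTheory GRing.Theory Num.Theory.

Local Open Scope ring_scope.

(* The norm that MathComp-Analysis puts on matrices is the sup norm, so the
   Euclidean norms are spelled out. *)
Definition l2norm (R : realType) (k : nat) (u : 'rV[R]_k) : R :=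
  Num.sqrt (\sum_(j < k) u 0 j ^+ 2).

Definition frobenius (R : realType) (n m : nat) (X : 'M[R]_(n, m)) : R :=
  Num.sqrt (\sum_(i < n) \sum_(j < m) X i j ^+ 2).

Definition max_row_prod (R : realType) (n m k : nat)
    (U : 'M[R]_(n, k)) (V : 'M[R]_(m, k)) : R :=
  \big[Num.max/0]_(i < n) \big[Num.max/0]_(j < m)
    (l2norm (row i U) * l2norm (row j V)).

(* The inner dimension [k] of the factorization is arbitrary. The set is
   nonempty (take [V = 1]) and bounded below by 0. *)
Definition gamma2 (R : realType) (n m : nat) (Y : 'M[R]_(n, m)) : R :=
  inf [set g : R | exists k (U : 'M[R]_(n, k)) (V : 'M[R]_(m, k)),
                     U *m V^T = Y /\ g = max_row_prod U V]%classic.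

Definition sign_rank1 (R : realType) (n m : nat) (S : 'M[R]_(n, m)) : Prop :=
  \rank S = 1%N /\ forall i j, S i j = 1 \/ S i j = -1.

(* The set is nonempty, since the rank-one sign matrices span ['M_(n, m)], and
   bounded below by 0. *)
Definition sign_nuclear (R : realType) (n m : nat) (X : 'M[R]_(n, m)) : R :=
  inf [set g : R | exists k (a : 'I_k -> R) (S : 'I_k -> 'M[R]_(n, m)),
                     [/\ forall i, sign_rank1 (S i),
                         X = \sum_(i < k) a i *: S i
                       & g = \sum_(i < k) `|a i|] ]%classic.

(* The best constant in Grothendieck's inequality, in the form
   [gamma2 X <= sign_nuclear X <= K * gamma2 X] for real matrices of all sizes;
   by duality it is the best [K] such that, for all real [A] and all unit
   vectors u_i, v_j, \sum_ij A_ij <u_i, v_j> is at most [K] times the maximum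
   of \sum_ij A_ij e_i f_j over signs e_i, f_j. *)
Definition grothendieck (R : realType) : R :=
  inf [set K : R | forall n m (X : 'M[R]_(n, m)),
                     sign_nuclear X <= K * gamma2 X]%classic.

Definition biregular (n m : nat) (d1 d2 : nat) (E : {set 'I_n * 'I_m}) : Prop :=
  (forall i : 'I_n, #|[set j : 'I_m | (i, j) \in E]| = d1) /\
  (forall j : 'I_m, #|[set i : 'I_n | (i, j) \in E]| = d2).

Definition adjmx (R : realType) (n m : nat) (E : {set 'I_n * 'I_m}) :
    'M[R]_(n + m) :=
  let B : 'M[R]_(n, m) := \matrix_(i, j) ((i, j) \in E)%:R in
  block_mx 0 B B^T 0.

(* [s] lists the eigenvalues of [A] with multiplicity, in decreasing order. It
   is unique, and it exists when [A] is symmetric. *)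
Definition eigenvalue_list (R : realType) (N : nat) (A : 'M[R]_N)
    (s : seq R) : Prop :=
  sorted >=%R s /\ char_poly A = \prod_(x <- s) ('X - x%:P).

(* [s`_1] would be a default value if [N < 2]. *)
Definition second_largest_eigenvalue (R : realType) (N : nat) (A : 'M[R]_N)
    (lambda : R) : Prop :=
  exists s : seq R,
    [/\ eigenvalue_list A s, (1 < size s)%N & lambda = s`_1].

Definition agree_on (R : realType) (n m : nat) (E : {set 'I_n * 'I_m})
    (X Y : 'M[R]_(n, m)) : Prop :=
  forall i j, (i, j) \in E -> X i j = Y i j.

Definition gamma2_completion (R : realType) (n m : nat)
    (E : {set 'I_n * 'I_m}) (Y Yhat : 'M[R]_(n, m)) : Prop :=
  agree_on E Yhat Y /\
  forall X : 'M[R]_(n, m), agree_on E X Y -> gamma2 Yhat <= gamma2 X.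

(* Main.v *)
Require Import Defs.
From HB Require Import structures.
From mathcomp Require Import all_boot all_order all_algebra.
From mathcomp Require Import mathcomp_extra boolp classical_sets reals.
From mathcomp Require Import functions ereal topology normedtype sequences.
From mathcomp Require Import measure lebesgue_measure measurable_realfun numfun.
From mathcomp Require Import lebesgue_integral exp trigo charge probability.
From mathcomp Require Import complex zify ring lra.

Set Implicit Arguments.
Unset Strict Implicit.
Unset Printing Implicit Defensive.

Import Order.TTheory GRing.Theory Num.Theory.
Import numFieldNormedType.Exports.

Local Open Scope ring_scope.

(** Write Z for Yhat - Y and W for the matrix of the squares of its entries. The
    mean of W over E is 0, because Yhat agrees with Y there, and the mean of W
    over all entries is the left-hand side. So the claim says that E samples W
    well.

    For a rank-one sign matrix the two means differ by at most
    eta / sqrt (d1 d2). This is the expander mixing lemma (sign_mixing), and it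
    rests on the fact that the second eigenvalue bounds the quadratic form of
    the adjacency matrix on the complement of the top eigenvector
    (rayleigh_le_second_eigenvalue). By linearity the means of W differ by at
    most this quantity times the sign nuclear norm of W (sign_nuclear_dual),
    which is at most K_G gamma_2(W) (grothendieck_spec). Finally Yhat minimizes
    gamma_2, so gamma_2(Z) <= 2 gamma_2(Y) and, gamma_2 being submultiplicative
    for entrywise products, gamma_2(W) <= 4 gamma_2(Y)^2
    (gamma2_sqr_diff_le).

    That K_G is finite, and the numerical bound on it, are Krivine's form of
    Grothendieck's inequality (sign_nuclear_le_gamma2). Let X_ij = <u_i, v_j>
    with vectors in the unit ball. If c satisfies sinh c <= 1, the power series
    of the sine gives unit vectors u'_i, v'_j with
    <u'_i, v'_j> = sin (c X_ij): tensor powers realize the monomials, the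
    norms are bounded by the series of sinh c (gamma2_le_sine), and padding
    makes them equal to 1 (gamma2_le_unit). The signs of
    <g, u'_i> and <g, v'_j> for a Gaussian vector g differ with probability
    equal to the angle between u'_i and v'_j over pi
    (gaussian_sign_process), so the mean of the product of the signs is
    (2 / pi) asin (sin (c X_ij)) = (2 c / pi) X_ij. Since finitely many sign
    patterns occur, this exhibits X as pi / (2 c) times a convex combination of
    rank-one sign matrices. The sine series is truncated to stay in finite
    dimension, and the error disappears in the limit (krivine_nuclear_le).

    The Gaussian vectors are built by induction on the dimension. The only
    property that is used is that the joint law of two linear forms depends on
    the Gram matrix of their coefficients alone (gaussian_process); it follows
    from the rotation invariance of the planar Gaussian measure
    (gauss_rotation). The measure of a planar wedge is then a linear function
    of its angle, because it is additive (wedge_angle). *)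

(** * Factorizations with bounded rows *)

Section Gamma2.
Variable R : realType.

(** A witness for the infimum that defines gamma_2, with the freedom of
    rescaling U and V against each other used up: the two bounds on the rows
    are equal. In this form the sum and the entrywise product are read off by
    juxtaposing and by tensoring the rows. *)
Definition gamma2_le (n m : nat) (X : 'M[R]_(n, m)) (s : R) : Prop :=
  exists k (U : 'M[R]_(n, k)) (V : 'M[R]_(m, k)),
    [/\ X = U *m V^T, forall i, \sum_k U i k ^+ 2 <= s
      & forall j, \sum_k V j k ^+ 2 <= s].

Lemma gamma2_le_weaken n m (X : 'M[R]_(n, m)) s t :
  s <= t -> gamma2_le X s -> gamma2_le X t.
Proof.
move=> st [k [U [V [-> Us Vs]]]]; exists k, U, V.
by split=> // i; apply: le_trans st.
Qed.

Lemma gamma2_le0 n m : gamma2_le (0 : 'M[R]_(n, m)) 0.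
Proof.
exists 0%N, 0, 0; rewrite mul0mx.
by split=> // i; rewrite big1 // => j; case: j.
Qed.

Lemma gamma2_leD n m (X Y : 'M[R]_(n, m)) s t :
  gamma2_le X s -> gamma2_le Y t -> gamma2_le (X + Y) (s + t).
Proof.
move=> [k [U [V [-> Us Vs]]]] [l [U' [V' [-> Us' Vs']]]].
exists (k + l)%N, (row_mx U U'), (row_mx V V').
rewrite tr_row_mx mul_row_col; split=> // i; rewrite big_split_ord /=;
  by apply: lerD; (under eq_bigr do rewrite ?row_mxEl ?row_mxEr).
Qed.

Lemma gamma2_leZ n m (X : 'M[R]_(n, m)) a s :
  gamma2_le X s -> gamma2_le (a *: X) (`|a| * s).
Proof.
move=> [k [U [V [-> Us Vs]]]].
pose b := Num.sqrt `|a|.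
have bE : b ^+ 2 = `|a| by rewrite sqr_sqrtr.
exists k, ((Num.sg a * b) *: U), (b *: V); split.
- rewrite linearZ /= -scalemxAl -scalemxAr scalerA -mulrA -expr2 bE.
  by rewrite -numEsg.
- move=> i; under eq_bigr do rewrite mxE exprMn exprMn bE.
  rewrite -mulr_sumr -mulrA -[leRHS]mul1r; apply: ler_pM.
  + exact: sqr_ge0.
  + by rewrite mulr_ge0 // sumr_ge0 // => j _; rewrite sqr_ge0.
  + by rewrite sqr_sg; case: eqP.
  + by apply: ler_wpM2l.
- move=> i; under eq_bigr do rewrite mxE exprMn bE.
  by rewrite -mulr_sumr ler_wpM2l.
Qed.

(** Schur: the rows of the entrywise product are the tensor products of the
    rows, and both inner products and squared norms are multiplicative on
    tensors. *)
Lemma gamma2_le_hadamard n m (X Y : 'M[R]_(n, m)) s t :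
  gamma2_le X s -> gamma2_le Y t ->
  gamma2_le (\matrix_(i, j) (X i j * Y i j)) (s * t).
Proof.
move=> [k [U [V [-> Us Vs]]]] [l [U' [V' [-> Us' Vs']]]].
have mxvec_pair (A : 'M[R]_(k, l)) p :
    mxvec A 0 (uncurry (@mxvec_index k l) p) = A p.1 p.2.
  by case: p => c1 c2; rewrite mxvecE.
have sum_mxvec p (A : 'M[R]_(p, k)) (A' : 'M[R]_(p, l)) i x y :
    \sum_c A i c ^+ 2 <= x -> \sum_c A' i c ^+ 2 <= y ->
    \sum_c (\matrix_(i0, c) mxvec (\matrix_(c1, c2) (A i0 c1 * A' i0 c2)) 0 c
           : 'M[R]_(p, k * l)) i c ^+ 2 <= x * y.
  move=> Ax Ay; under eq_bigr do rewrite mxE.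
  rewrite (reindex _ (curry_mxvec_bij _ _)) /=.
  under eq_bigr do rewrite mxvec_pair mxE exprMn.
  rewrite -(pair_bigA _ (fun c1 c2 => A i c1 ^+ 2 * A' i c2 ^+ 2)) /=.
  under eq_bigr do rewrite -mulr_sumr.
  rewrite -mulr_suml.
  by apply: ler_pM => //; apply: sumr_ge0 => c _; rewrite sqr_ge0.
exists (k * l)%N,
  (\matrix_(i0, c) mxvec (\matrix_(c1, c2) (U i0 c1 * U' i0 c2)) 0 c),
  (\matrix_(i0, c) mxvec (\matrix_(c1, c2) (V i0 c1 * V' i0 c2)) 0 c).
split=> [|i|j]; try exact: sum_mxvec.
apply/matrixP=> i j; rewrite !mxE.
rewrite [RHS](reindex _ (curry_mxvec_bij _ _)) /=.
under [RHS]eq_bigr do rewrite !mxE !mxvec_pair !mxE.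
rewrite -(pair_bigA _ (fun c1 c2 => U i c1 * U' i c2 * (V j c1 * V' j c2))) /=.
rewrite mulr_suml; apply: eq_bigr => c1 _; rewrite mulr_sumr.
by apply: eq_bigr => c2 _; rewrite !mxE; ring.
Qed.

Lemma gamma2_le_pow n m (X : 'M[R]_(n, m)) p :
  gamma2_le X 1 -> gamma2_le (\matrix_(i, j) X i j ^+ p) 1.
Proof.
move=> X1; elim: p => [|p IHp].
  exists 1%N, (const_mx 1), (const_mx 1); split.
  - by apply/matrixP=> i j; rewrite !mxE big_ord1 !mxE mulr1.
  - by move=> i; rewrite big_ord1 mxE expr1n.
  - by move=> i; rewrite big_ord1 mxE expr1n.
have := gamma2_le_hadamard X1 IHp; rewrite mulr1; congr gamma2_le.
by apply/matrixP=> i j; rewrite !mxE exprS.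
Qed.

Lemma cauchy_schwarz k (u v : 'I_k -> R) :
  (\sum_c u c * v c) ^+ 2 <= (\sum_c u c ^+ 2) * (\sum_c v c ^+ 2).
Proof.
have v_ge0 : 0 <= \sum_c v c ^+ 2 by apply: sumr_ge0 => c _; rewrite sqr_ge0.
have [v0|v0] := eqVneq (\sum_c v c ^+ 2) 0.
  suff -> : \sum_c u c * v c = 0 by rewrite expr0n v0 mulr0.
  apply: big1 => c _; suff -> : v c = 0 by rewrite mulr0.
  apply/eqP; rewrite -sqrf_eq0; move/eqP: v0.
  rewrite psumr_eq0 => [/allP/(_ c (mem_index_enum _))//|j _].
  by rewrite sqr_ge0.
set p := \sum_c u c * v c; set q := \sum_c v c ^+ 2.
have q_gt0 : 0 < q by rewrite lt_neqAle eq_sym v0.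
have : 0 <= \sum_c (q * u c - p * v c) ^+ 2.
  by apply: sumr_ge0 => c _; rewrite sqr_ge0.
have -> : \sum_c (q * u c - p * v c) ^+ 2 = q * (q * \sum_c u c ^+ 2 - p ^+ 2).
  have e c : (q * u c - p * v c) ^+ 2
    = q ^+ 2 * u c ^+ 2 - 2 * p * q * (u c * v c) + p ^+ 2 * v c ^+ 2 by ring.
  under eq_bigr do rewrite e.
  by rewrite big_split /= sumrB -!mulr_sumr -/p -/q; ring.
by rewrite pmulr_rge0 // subr_ge0 mulrC.
Qed.

Lemma gamma2_le_entry n m (X : 'M[R]_(n, m)) s i j :
  gamma2_le X s -> `|X i j| <= s.
Proof.
move=> [k [U [V [-> /(_ i) Us /(_ j) Vs]]]].
have U_ge0 : 0 <= \sum_c U i c ^+ 2 by apply: sumr_ge0 => c _; rewrite sqr_ge0.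
have V_ge0 : 0 <= \sum_c V j c ^+ 2 by apply: sumr_ge0 => c _; rewrite sqr_ge0.
rewrite -ler_sqr ?nnegrE ?normr_ge0 ?(le_trans U_ge0) //.
rewrite real_normK ?num_real //.
rewrite mxE; under eq_bigr do rewrite mxE.
by apply: le_trans (cauchy_schwarz _ _) _; rewrite expr2 ler_pM.
Qed.

Lemma l2norm_sqr k (u : 'rV[R]_k) : l2norm u ^+ 2 = \sum_c u 0 c ^+ 2.
Proof. by rewrite sqr_sqrtr // sumr_ge0 // => c _; rewrite sqr_ge0. Qed.

Lemma max_row_prod_ge n m k (U : 'M[R]_(n, k)) (V : 'M[R]_(m, k)) i j :
  l2norm (row i U) * l2norm (row j V) <= max_row_prod U V.
Proof.
rewrite /max_row_prod.
apply: le_trans (le_bigmax _ (fun i => \big[Num.max/0]_(j < m)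
    (l2norm (row i U) * l2norm (row j V))) i).
exact: (le_bigmax _ (fun j => l2norm (row i U) * l2norm (row j V))).
Qed.

Lemma max_row_prod_ge0 n m k (U : 'M[R]_(n, k)) (V : 'M[R]_(m, k)) :
  0 <= max_row_prod U V.
Proof. exact: bigmax_ge_id. Qed.

(** The product a b of the largest row norms of U and V is attained at a single
    pair (i, j), so it is at most max_row_prod U V; scaling U by sqrt (b / a)
    and V by sqrt (a / b) makes every row have squared norm at most a b. *)
Lemma gamma2_le_max_row_prod n m k (U : 'M[R]_(n, k)) (V : 'M[R]_(m, k)) s :
  max_row_prod U V <= s -> gamma2_le (U *m V^T) s.
Proof.
move=> UVs.
pose a := \big[Num.max/0]_(i < n) l2norm (row i U).
pose b := \big[Num.max/0]_(j < m) l2norm (row j V).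
have U_le i : l2norm (row i U) <= a.
  exact: (le_bigmax _ (fun i => l2norm (row i U))).
have V_le j : l2norm (row j V) <= b.
  exact: (le_bigmax _ (fun i => l2norm (row i V))).
have a_ge0 : 0 <= a := bigmax_ge_id _ _ _ _.
have b_ge0 : 0 <= b := bigmax_ge_id _ _ _ _.
have s_ge0 : 0 <= s := le_trans (max_row_prod_ge0 U V) UVs.
have sqrU i : \sum_c U i c ^+ 2 = l2norm (row i U) ^+ 2.
  by rewrite l2norm_sqr; apply: eq_bigr => c _; rewrite mxE.
have sqrV i : \sum_c V i c ^+ 2 = l2norm (row i V) ^+ 2.
  by rewrite l2norm_sqr; apply: eq_bigr => c _; rewrite mxE.
have row_l2norm0 p (A : 'M[R]_(p, k)) :
    (forall i, \sum_c A i c ^+ 2 = 0) -> A = 0.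
  move=> A0; apply/matrixP=> i c; rewrite mxE; apply/eqP; rewrite -sqrf_eq0.
  move/eqP: (A0 i).
  rewrite psumr_eq0 => [/allP/(_ c (mem_index_enum _))//|j _].
  by rewrite sqr_ge0.
have [a0|a0] := eqVneq a 0.
  rewrite (row_l2norm0 _ U) ?mul0mx; last first.
    move=> i; apply/eqP; rewrite sqrU sqrf_eq0 eq_le sqrtr_ge0 andbT.
    by rewrite -a0.
  exact: gamma2_le_weaken s_ge0 (gamma2_le0 _ _).
have [b0|b0] := eqVneq b 0.
  rewrite (row_l2norm0 _ V) ?trmx0 ?mulmx0; last first.
    move=> i; apply/eqP; rewrite sqrV sqrf_eq0 eq_le sqrtr_ge0 andbT.
    by rewrite -b0.
  exact: gamma2_le_weaken s_ge0 (gamma2_le0 _ _).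
have a_gt0 : 0 < a by rewrite lt_neqAle eq_sym a0.
have b_gt0 : 0 < b by rewrite lt_neqAle eq_sym b0.
have ab_le : a * b <= s.
  rewrite -ler_pdivlMr //; apply: bigmax_le; first by rewrite divr_ge0.
  move=> i _; rewrite ler_pdivlMr // mulrC.
  have [->|u0] := eqVneq (l2norm (row i U)) 0; first by rewrite mulr0.
  have u_gt0 : 0 < l2norm (row i U) by rewrite lt_neqAle eq_sym u0 sqrtr_ge0.
  rewrite -ler_pdivlMr //; apply: bigmax_le.
    by rewrite divr_ge0 // ltW.
  move=> j _; rewrite ler_pdivlMr // mulrC.
  exact: le_trans (max_row_prod_ge U V i j) UVs.
pose t := Num.sqrt (b / a).
have t_gt0 : 0 < t by rewrite sqrtr_gt0 divr_gt0.
have tE : t ^+ 2 = b / a by rewrite sqr_sqrtr // divr_ge0.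
exists k, (t *: U), (t^-1 *: V); split.
- rewrite linearZ /= -scalemxAl -scalemxAr scalerA divff ?scale1r //.
  by rewrite gt_eqF.
- move=> i; under eq_bigr do rewrite mxE exprMn tE.
  rewrite -mulr_sumr sqrU; apply: le_trans ab_le.
  have -> : a * b = b / a * a ^+ 2 by field; rewrite a0.
  by rewrite ler_wpM2l ?divr_ge0 // ler_sqr ?nnegrE ?sqrtr_ge0.
- move=> i; under eq_bigr do rewrite mxE exprMn exprVn tE.
  rewrite -mulr_sumr sqrV; apply: le_trans ab_le.
  have -> : a * b = (b / a)^-1 * b ^+ 2 by field; rewrite a0 b0.
  by rewrite ler_wpM2l ?invr_ge0 ?divr_ge0 // ler_sqr ?nnegrE ?sqrtr_ge0.
Qed.

Section Bounds.
Variables (n m : nat) (X : 'M[R]_(n, m)).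

Let factorizations : set R := [set g : R | exists k (U : 'M[R]_(n, k))
  (V : 'M[R]_(m, k)), U *m V^T = X /\ g = max_row_prod U V]%classic.

Let factorizations_lb : lbound factorizations 0.
Proof. by move=> _ [k [U [V [_ ->]]]]; exact: max_row_prod_ge0. Qed.

Lemma gamma2_ge0 : 0 <= gamma2 X.
Proof.
apply: lb_le_inf factorizations_lb.
by exists (max_row_prod X 1%:M), m, X, 1%:M; rewrite trmx1 mulmx1.
Qed.

Lemma gamma2_lt_gamma2_le s : gamma2 X < s -> gamma2_le X s.
Proof.
move=> Xs; have : has_inf factorizations.
  split; last by exists 0; exact: factorizations_lb.
  by exists (max_row_prod X 1%:M), m, X, 1%:M; rewrite trmx1 mulmx1.
have gap : 0 < s - gamma2 X by rewrite subr_gt0.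
move=> /(inf_adherent gap)[_ [k [U [V [UV ->]]]]]; rewrite subrKC => UVs.
by rewrite -UV; exact/gamma2_le_max_row_prod/ltW.
Qed.

Lemma gamma2_ub s : 0 <= s -> gamma2_le X s -> gamma2 X <= s.
Proof.
move=> s_ge0 [k [U [V [XE Us Vs]]]].
apply: le_trans (_ : max_row_prod U V <= s).
  by apply: ge_inf; [exists 0; exact: factorizations_lb | exists k, U, V].
apply: bigmax_le => // i _; apply: bigmax_le => // j _.
rewrite -ler_sqr ?nnegrE ?mulr_ge0 ?sqrtr_ge0 // exprMn !l2norm_sqr expr2.
apply: ler_pM; try by apply: sumr_ge0 => c _; rewrite sqr_ge0.
  by under eq_bigr do rewrite mxE.
by under eq_bigr do rewrite mxE.
Qed.

End Bounds.
End Gamma2.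

(** * Decompositions into rank-one sign matrices *)

Section SignNuclear.
Variable R : realType.

Lemma sign_rank1_outer n m (a : 'I_n -> R) (b : 'I_m -> R) :
  (0 < n)%N -> (0 < m)%N ->
  (forall i, a i = 1 \/ a i = -1) -> (forall j, b j = 1 \/ b j = -1) ->
  sign_rank1 (\matrix_(i, j) (a i * b j)).
Proof.
move=> n_gt0 m_gt0 a_sign b_sign; split; last first.
  move=> i j; rewrite mxE.
  by case: (a_sign i) (b_sign j) => -> [] ->; rewrite ?mulN1r ?opprK ?mul1r;
    [left | right | right | left].
have -> : \matrix_(i, j) (a i * b j) = (\col_i a i) *m (\row_j b j).
  by apply/matrixP=> i j; rewrite !mxE big_ord1 !mxE.
apply/eqP; rewrite eqn_leq (leq_trans (mxrankM_maxl _ _) (rank_leq_col _)) /=.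
rewrite lt0n mxrank_eq0; apply/eqP => /matrixP.
move=> /(_ (Ordinal n_gt0) (Ordinal m_gt0))/eqP.
rewrite !mxE big_ord1 !mxE mulf_eq0.
by case: (a_sign (Ordinal n_gt0)) (b_sign (Ordinal m_gt0)) => -> [] ->;
  rewrite ?oppr_eq0 oner_eq0.
Qed.

(** All 2 x 2 minors of a rank-one matrix vanish, so each entry is determined by
    the first row and the first column. *)
Lemma sign_rank1_factor n m (S : 'M[R]_(n, m)) :
  sign_rank1 S -> exists (a : 'rV[R]_n) (b : 'rV[R]_m),
    [/\ forall i, a 0 i ^+ 2 = 1, forall j, b 0 j ^+ 2 = 1
      & forall i j, S i j = a 0 i * b 0 j].
Proof.
move=> [rankS signS].
have sqrS i j : S i j ^+ 2 = 1.
  by case: (signS i j) => ->; rewrite ?sqrrN expr1n.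
have minorS i j k l : S i j * S k l = S i l * S k j.
  have minor1 r (A : 'M[R]_(n, r)) (B : 'M[R]_(r, m)) : r = 1%N ->
      (A *m B) i j * (A *m B) k l = (A *m B) i l * (A *m B) k j.
    by move=> r1; subst r; rewrite !mxE !big_ord1; ring.
  by have := minor1 _ (col_base S) (row_base S) rankS; rewrite mulmx_base.
case: n m S {rankS signS} sqrS minorS => [|n] [|m] S sqrS minorS.
- by exists (const_mx 1), (const_mx 1); split=> [[]|[]|[]].
- exists (const_mx 1), (const_mx 1); split=> [[]//|j|[]//].
  by rewrite mxE expr1n.
- exists (const_mx 1), (const_mx 1); split=> [i|[]//|i []//].
  by rewrite mxE expr1n.
exists (\row_i S i ord0), (\row_j (S ord0 ord0 * S ord0 j)).
split=> [i|j|i j]; rewrite !mxE ?exprMn ?sqrS ?mulr1 //.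
by rewrite mulrCA (minorS i) mulrCA -expr2 sqrS mulr1.
Qed.

Definition nuclear_le n m (X : 'M[R]_(n, m)) (g : R) : Prop :=
  exists k (a : 'I_k -> R) (S : 'I_k -> 'M[R]_(n, m)),
    [/\ forall i, sign_rank1 (S i), X = \sum_(i < k) a i *: S i
      & \sum_(i < k) `|a i| <= g].

Lemma nuclear_le_weaken n m (X : 'M[R]_(n, m)) g h :
  g <= h -> nuclear_le X g -> nuclear_le X h.
Proof.
move=> gh [k [a [S [S1 XE ag]]]]; exists k, a, S.
by split=> //; apply: le_trans gh.
Qed.

Lemma nuclear_le0 n m : nuclear_le (0 : 'M[R]_(n, m)) 0.
Proof.
exists 0%N, (fun=> 0), (fun=> 0); rewrite !big_ord0.
by split=> // [[]].
Qed.

Lemma nuclear_leD n m (X Y : 'M[R]_(n, m)) g h :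
  nuclear_le X g -> nuclear_le Y h -> nuclear_le (X + Y) (g + h).
Proof.
move=> [k [a [S [S1 -> ag]]]] [l [b [T [T1 -> bh]]]].
exists (k + l)%N,
  (fun i => match fintype.split i with inl j => a j | inr j => b j end),
  (fun i => match fintype.split i with inl j => S j | inr j => T j end).
have lsh (j : 'I_k) : fintype.split (lshift l j) = inl j := unsplitK (inl j).
have rsh (j : 'I_l) : fintype.split (rshift k j) = inr j := unsplitK (inr j).
split=> [i||]; first by case: (fintype.split i).
  rewrite big_split_ord /=; congr (_ + _); apply: eq_bigr => i _.
    by rewrite lsh.
  by rewrite rsh.
rewrite big_split_ord /= lerD //; under eq_bigr do rewrite ?lsh ?rsh.
  exact: ag.
exact: bh.
Qed.

Lemma nuclear_leZ n m (X : 'M[R]_(n, m)) c g :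
  nuclear_le X g -> nuclear_le (c *: X) (`|c| * g).
Proof.
move=> [k [a [S [S1 -> ag]]]]; exists k, (fun i => c * a i), S; split=> //.
  by rewrite scaler_sumr; apply: eq_bigr => i _; rewrite scalerA.
under eq_bigr do rewrite normrM.
by rewrite -mulr_sumr ler_wpM2l.
Qed.

Lemma nuclear_le_sum n m (I : finType) (X : I -> 'M[R]_(n, m)) (g : I -> R) :
  (forall i, nuclear_le (X i) (g i)) ->
  nuclear_le (\sum_i X i) (\sum_i g i).
Proof.
move=> Xg; apply: (big_ind2 (@nuclear_le n m)) => //.
- exact: nuclear_le0.
- by move=> *; apply: nuclear_leD.
Qed.

Lemma nuclear_le_sign n m (S : 'M[R]_(n, m)) : sign_rank1 S -> nuclear_le S 1.
Proof.
move=> S1; exists 1%N, (fun=> 1), (fun=> S).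
by rewrite !big_ord1 scale1r normr1.
Qed.

(** Each elementary matrix is the average of four rank-one sign matrices,
    because the indicator of an index is (1 + s) / 2 for a sign vector s. So the
    sign nuclear norm is finite and vanishes with the entries, which is all that
    the limit in Krivine's argument needs. *)
Lemma nuclear_le_entries n m (X : 'M[R]_(n, m)) :
  (0 < n)%N -> (0 < m)%N -> nuclear_le X (\sum_i \sum_j `|X i j|).
Proof.
move=> n_gt0 m_gt0; rewrite [X in nuclear_le X]matrix_sum_delta.
apply: nuclear_le_sum => i; apply: nuclear_le_sum => j.
rewrite -[`|X i j|]mulr1; apply: nuclear_leZ.
pose one p (k : 'I_p) : R := 1.
pose s p (k0 k : 'I_p) : R := (-1) ^+ (k != k0).
have one_sign p (k : 'I_p) : one p k = 1 \/ one p k = -1 by left.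
have s_sign p (k0 k : 'I_p) : s p k0 k = 1 \/ s p k0 k = -1.
  by rewrite /s; case: (k != k0); [right; rewrite expr1 | left; rewrite expr0].
have quarter (a : 'I_n -> R) (b : 'I_m -> R) :
    (forall i, a i = 1 \/ a i = -1) -> (forall j, b j = 1 \/ b j = -1) ->
    nuclear_le (4^-1 *: \matrix_(i, j) (a i * b j)) 4^-1.
  move=> ha hb; rewrite -[X in nuclear_le _ X]mulr1.
  rewrite -[X in nuclear_le _ (X * 1)]ger0_norm ?invr_ge0 ?ler0n //.
  exact/nuclear_leZ/nuclear_le_sign/sign_rank1_outer.
have := nuclear_leD
  (nuclear_leD (quarter _ _ (@one_sign n) (@one_sign m))
               (quarter _ _ (@one_sign n) (s_sign m j)))
  (nuclear_leD (quarter _ _ (s_sign n i) (@one_sign m))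
               (quarter _ _ (s_sign n i) (s_sign m j))).
have -> : 4^-1 + 4^-1 + (4^-1 + 4^-1) = 1 :> R by field.
congr nuclear_le; apply/matrixP=> k l; rewrite !mxE /one /s.
by case: (k == i); case: (l == j); rewrite /= ?expr0 ?expr1; field.
Qed.

Section Bounds.
Variables (n m : nat) (X : 'M[R]_(n, m)).

Let decompositions : set R :=
  [set g : R | exists k (a : 'I_k -> R) (S : 'I_k -> 'M[R]_(n, m)),
     [/\ forall i, sign_rank1 (S i), X = \sum_(i < k) a i *: S i
       & g = \sum_(i < k) `|a i|]]%classic.

Let decompositions_lb : lbound decompositions 0.
Proof. by move=> _ [k [a [S [_ _ ->]]]]; exact: sumr_ge0. Qed.

Lemma sign_nuclear_ge0 : 0 <= sign_nuclear X.
Proof.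
rewrite /sign_nuclear -/decompositions.
have [->|/set0P X_neq0] := eqVneq decompositions set0; first by rewrite inf0.
exact: lb_le_inf decompositions_lb.
Qed.

Lemma sign_nuclear_ub g : nuclear_le X g -> sign_nuclear X <= g.
Proof.
move=> [k [a [S [S1 XE ag]]]]; apply: le_trans ag.
by apply: ge_inf; [exists 0; exact: decompositions_lb | exists k, a, S].
Qed.

(** The easy half of the duality between the sign nuclear norm and the maximum
    of a linear functional over rank-one sign matrices. A one-sided bound
    suffices because these matrices are closed under negation. *)
Lemma sign_nuclear_dual (w : 'M[R]_(n, m)) (q : R) :
  (0 < n)%N -> (0 < m)%N -> 0 <= q ->
  (forall S, sign_rank1 S -> \sum_i \sum_j w i j * S i j <= q) ->
  \sum_i \sum_j w i j * X i j <= q * sign_nuclear X.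
Proof.
move=> n_gt0 m_gt0 q_ge0 wq.
pose phi (Y : 'M[R]_(n, m)) := \sum_i \sum_j w i j * Y i j.
have phiN Y : phi (- Y) = - phi Y.
  rewrite /phi -sumrN; apply: eq_bigr => i _; rewrite -sumrN.
  by apply: eq_bigr => j _; rewrite mxE mulrN.
have wq_abs S : sign_rank1 S -> `|phi S| <= q.
  move=> S1; rewrite ler_norml lerNl -phiN; apply/andP; split; apply: wq => //.
  case: S1 => rS sS; split; first by rewrite mxrank_opp.
  move=> i j; rewrite mxE; case: (sS i j) => ->; rewrite ?opprK.
    by right.
  by left.
have bound g : decompositions g -> phi X <= q * g.
  move=> [k [a [S [S1 -> ->]]]].
  have -> : phi (\sum_(i < k) a i *: S i) = \sum_(i < k) a i * phi (S i).
    rewrite /phi; under eq_bigr do under eq_bigr do rewrite summxE mulr_sumr.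
    under eq_bigr do rewrite exchange_big /=.
    rewrite exchange_big /=; apply: eq_bigr => t _; rewrite mulr_sumr.
    apply: eq_bigr => i _; rewrite mulr_sumr.
    by apply: eq_bigr => j _; rewrite mxE mulrCA.
  rewrite mulr_sumr; apply: ler_sum => i _; rewrite mulrC.
  apply: le_trans (ler_norm _) _; rewrite normrM.
  by rewrite ler_wpM2r // wq_abs.
have [g0 Xg0] : exists g, decompositions g.
  have [k [a [S [S1 XE _]]]] := nuclear_le_entries X n_gt0 m_gt0.
  by exists (\sum_(i < k) `|a i|), k, a, S.
have [q0|q_neq0] := eqVneq q 0.
  by have := bound _ Xg0; rewrite q0 !mul0r.
have q_gt0 : 0 < q by rewrite lt_neqAle eq_sym q_neq0.
rewrite mulrC -ler_pdivrMr //; apply: lb_le_inf; first by exists g0.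
by move=> g /bound; rewrite ler_pdivrMr // mulrC.
Qed.

End Bounds.
End SignNuclear.

(** * The second eigenvalue as a constrained Rayleigh quotient *)

Section Rayleigh.
Local Open Scope sesquilinear_scope.

Lemma char_poly_conj (F : fieldType) (N : nat) (P D : 'M[F]_N) :
  P \in unitmx -> char_poly (invmx P *m D *m P) = char_poly D.
Proof.
move=> uP; rewrite /char_poly.
have <- : map_mx polyC (invmx P) *m char_poly_mx D *m map_mx polyC P
          = char_poly_mx (invmx P *m D *m P).
  rewrite /char_poly_mx mulmxBr mulmxBl !map_mxM; congr (_ - _).
  by rewrite scalar_mxC -mulmxA -map_mxM mulVmx // map_mx1 mulmx1.
rewrite !det_mulmx mulrAC -det_mulmx -map_mxM mulVmx // map_mx1 det1.
by rewrite mul1r.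
Qed.

Lemma char_poly_diag (F : fieldType) (N : nat) (d : 'rV[F]_N) :
  char_poly (diag_mx d) = \prod_(i < N) ('X - (d 0 i)%:P).
Proof.
rewrite char_poly_trig; last exact/diag_mx_is_trig.
by apply: eq_bigr => i _; rewrite mxE eqxx.
Qed.

(** Eigenvalues with multiplicity form a multiset. Removing one index whose
    entry is the top of the sorted list leaves entries that all lie further down
    the list. *)
Lemma all_but_one_le (R : rcfType) (N : nat) (d : 'rV[R[i]]_N)
    (s : seq R) :
  sorted >=%R s -> (1 < size s)%N ->
  \prod_(i < N) ('X - (d 0 i)%:P)
    = \prod_(x <- s) ('X - (x%:C)%:P)%C ->
  exists i0 : 'I_N, forall i, i != i0 -> d 0 i <= (s`_1)%:C%C.
Proof.
case: s => [//|a [//|b t]] s_sorted _ eq_prod.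
pose e := [seq d 0 i | i <- index_enum 'I_N].
have e_perm : perm_eq e [seq x%:C%C | x <- a :: b :: t].
  by apply: prod_XsubC_eq; rewrite /e !big_map eq_prod.
have /mapP[i0 _ ai0] : a%:C%C \in e by rewrite (perm_mem e_perm) mem_head.
exists i0 => i ii0 /=.
have : perm_eq [seq d 0 i | i <- rem i0 (index_enum 'I_N)]
               [seq x%:C%C | x <- b :: t].
  rewrite -(perm_cons a%:C%C) {1}ai0 -map_cons.
  apply: perm_trans e_perm; apply: perm_map.
  by rewrite perm_sym perm_to_rem // mem_index_enum.
move=> /perm_mem /(_ (d 0 i)).
have -> : d 0 i \in [seq d 0 i | i <- rem i0 (index_enum 'I_N)].
  by apply: map_f; rewrite rem_filter ?index_enum_uniq // mem_filter inE ii0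
     mem_index_enum.
move=> /esym /mapP[x x_in ->]; rewrite lecR.
move: s_sorted => /= /andP[_ ]; rewrite (path_sortedE (rev_trans le_trans)).
move=> /andP[/allP ble _].
by move: x_in; rewrite inE => /predU1P[->//|/ble].
Qed.

Lemma bilinear_expand (K : comNzRingType) (N : nat) (B : 'M[K]_N)
    (v x : 'rV[K]_N) (v' x' : 'cV[K]_N) (a b a' b' : K) :
  ((a *: v + b *: x) *m B *m (a' *: v' + b' *: x')) 0 0
  = a * a' * (v *m B *m v') 0 0 + a * b' * (v *m B *m x') 0 0
    + b * a' * (x *m B *m v') 0 0 + b * b' * (x *m B *m x') 0 0.
Proof.
rewrite !mulmxDl !mulmxDr -!scalemxAl -!scalemxAr !mxE.
ring.
Qed.

Lemma sesquilinear_expand (R : rcfType) (N : nat) (B : 'M[R]_N)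
    (v x : 'rV[R]_N) (a b : R[i]) :
  let toC k l := map_mx (real_complex R) : 'M[R]_(k, l) -> 'M[R[i]]_(k, l) in
  let y := a *: toC _ _ v + b *: toC _ _ x in
  (y *m toC _ _ B *m y^t*) 0 0
  = a * a^* * ((v *m B *m v^T) 0 0)%:C%C + a * b^* * ((v *m B *m x^T) 0 0)%:C%C
    + b * a^* * ((x *m B *m v^T) 0 0)%:C%C
    + b * b^* * ((x *m B *m x^T) 0 0)%:C%C.
Proof.
move=> toC y.
have conj_toC (u : 'rV[R]_N) : (toC _ _ u)^t* = toC _ _ u^T.
  apply/matrixP=> i j; rewrite !mxE conj_Creal //.
  by apply/complex_realP; eexists.
have entry (u w : 'rV[R]_N) :
    ((u *m B *m w^T) 0 0)%:C%C = (toC _ _ u *m toC _ _ B *m toC _ _ w^T) 0 0.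
  by rewrite /toC -!map_mxM [RHS]mxE.
rewrite !entry /y !linearD /= !linearZ /= map_mxD !map_mxZ !conj_toC.
exact: bilinear_expand.
Qed.

Lemma spectral_sum (R : rcfType) (N : nat) (A : 'M[R[i]]_N)
    (y : 'rV[R[i]]_N) :
  A \is normalmx ->
  (y *m A *m y^t*) 0 0
  = \sum_i spectral_diag A 0 i * `|(y *m (spectralmx A)^t*) 0 i| ^+ 2.
Proof.
move=> /orthomx_spectralP {1}->; rewrite invmx_unitary ?spectral_unitarymx //.
set P := spectralmx A; set z := y *m P^t*.
have -> : y *m (P^t* *m diag_mx (spectral_diag A) *m P) *m y^t*
          = z *m diag_mx (spectral_diag A) *m z^t*.
  by rewrite /z trmx_mul map_mxM /= trmxCK !mulmxA.
rewrite mul_mx_diag mxE; apply: eq_bigr => i _.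
by rewrite !mxE normCK mulrCA mulrA.
Qed.

(** Courant-Fischer, in the one case that is needed. If x violated the bound
    then r would exceed lambda too, and v and x would span a plane on which the
    form is larger than lambda times the squared norm. But some nonzero vector
    of that plane has no component along the top eigenvector, and there the form
    is not larger. The spectral theorem is used over the complex numbers, so the
    coefficients of that vector are complex. *)
Lemma rayleigh_le_second_eigenvalue (R : realType) (N : nat) (A : 'M[R]_N)
    (lambda r : R) (v x : 'rV[R]_N) :
  A^T = A -> second_largest_eigenvalue A lambda ->
  v *m A = r *: v -> v != 0 -> v *m x^T = 0 ->
  (x *m A *m x^T) 0 0 <= r * (x *m x^T) 0 0 ->
  (x *m A *m x^T) 0 0 <= lambda * (x *m x^T) 0 0.
Proof.
move=> A_sym [s [[s_sorted char_A] s_gt1 ->]] v_eig v_neq0 vx0 q_le_r.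
set q := (x *m A *m x^T) 0 0 in q_le_r *; set l := s`_1.
have sqE (u : 'rV[R]_N) : (u *m u^T) 0 0 = \sum_i u 0 i ^+ 2.
  by rewrite mxE; apply: eq_bigr => i _; rewrite mxE expr2.
have sq_ge0 (u : 'rV[R]_N) : 0 <= (u *m u^T) 0 0.
  by rewrite sqE sumr_ge0 // => i _; rewrite sqr_ge0.
have v_gt0 : 0 < (v *m v^T) 0 0.
  rewrite lt_neqAle sq_ge0 andbT eq_sym; apply: contraNneq v_neq0 => v0.
  apply/eqP/rowP=> i; rewrite mxE; apply/eqP; rewrite -sqrf_eq0.
  move/eqP: v0; rewrite sqE psumr_eq0 => [/allP/(_ i (mem_index_enum _))//|j _].
  by rewrite sqr_ge0.
rewrite leNgt; apply/negP => q_gt_l.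
have l_lt_r : l < r.
  have x_gt0 : 0 < (x *m x^T) 0 0.
    rewrite lt_neqAle sq_ge0 andbT eq_sym; apply/eqP => x0.
    by move: q_gt_l q_le_r; rewrite x0 !mulr0 => /lt_le_trans h/h; rewrite ltxx.
  by rewrite -(ltr_pM2r x_gt0) (lt_le_trans q_gt_l).
pose toC k l := map_mx (real_complex R) : 'M[R]_(k, l) -> 'M[R[i]]_(k, l).
have A_normal : toC _ _ A \is normalmx.
  apply/hermitian_normalmx/realsym_hermsym.
    by apply/is_hermitianmxP; rewrite expr0 scale1r map_mx_id //
      /toC map_trmx A_sym.
  by apply/mxOverP=> i j; rewrite mxE; apply/complex_realP; exists (A i j).
set P := spectralmx (toC _ _ A); set d := spectral_diag (toC _ _ A).
have P_unitary : P \is unitarymx := spectral_unitarymx _.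
have [i0 d_le] : exists i0, forall i, i != i0 -> d 0 i <= (s`_1)%:C%C.
  apply: all_but_one_le => //.
  rewrite -char_poly_diag -(char_poly_conj _ (unitarymx_unit P_unitary)).
  have /orthomx_spectralP <- := A_normal.
  rewrite -map_char_poly char_A rmorph_prod; apply: eq_bigr => z _.
  by rewrite rmorphB /= map_polyX map_polyC.
pose z (u : 'rV[R]_N) : R[i] := (toC _ _ u *m P^t*) 0 i0.
have [a [b [ab_neq0 zab0]]] :
    exists a b : R[i], (a != 0 \/ b != 0) /\ a * z v + b * z x = 0.
  have [zv0|zv0] := eqVneq (z v) 0.
    by exists 1, 0; rewrite oner_neq0 zv0 mulr0 mul0r addr0; split; first left.
  exists (z x), (- z v); rewrite oppr_eq0 zv0; split; first by right.
  by rewrite mulNr mulrC subrr.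
set y := a *: toC _ _ v + b *: toC _ _ x.
have y_le : (y *m toC _ _ A *m y^t*) 0 0 <= l%:C%C * (y *m y^t*) 0 0.
  rewrite spectral_sum //.
  have -> : (y *m y^t*) 0 0 = \sum_i `|(y *m P^t*) 0 i| ^+ 2.
    have -> : y *m y^t* = (y *m P^t*) *m (y *m P^t*)^t*.
      rewrite trmx_mul map_mxM /= trmxCK mulmxA.
      by rewrite mulmxKtV.
    by rewrite mxE; apply: eq_bigr => i _; rewrite !mxE normCK.
  rewrite mulr_sumr; apply: ler_sum => i _; have [->|ii0] := eqVneq i i0.
    have -> : (y *m P^t*) 0 i0 = 0.
      rewrite /y mulmxDl -!scalemxAl mxE [X in X + _]mxE [X in _ + X]mxE.
      exact: zab0.
    by rewrite normr0 expr0n !mulr0.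
  by rewrite ler_wpM2r ?exprn_ge0 ?normr_ge0 // d_le.
move: y_le; rewrite /y.
have -> : (y *m y^t*) 0 0 = (y *m toC _ _ 1%:M *m y^t*) 0 0.
  by rewrite /toC map_mx1 mulmx1.
rewrite !sesquilinear_expand !mulmx1 v_eig -!scalemxAl vx0 -/q.
have -> : x *m A *m v^T = 0.
  apply: trmx_inj; rewrite !trmx_mul trmxK A_sym mulmxA v_eig -scalemxAl.
  by rewrite vx0 scaler0 trmx0.
have -> : x *m v^T = 0 by apply: trmx_inj; rewrite trmx_mul trmxK vx0 trmx0.
have zero00 : (0 : 'M[R]_1) 0 0 = 0 by rewrite mxE.
have scale00 (M : 'M[R]_1) : (r *: M) 0 0 = r * M 0 0 by rewrite mxE.
rewrite scaler0 !zero00 scale00 -!normCK !rmorph0 !mulr0 !addr0 => y_le.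
have : `|a| ^+ 2 * ((r - l) * (v *m v^T) 0 0)%:C%C
       + `|b| ^+ 2 * (q - l * (x *m x^T) 0 0)%:C%C <= 0.
  rewrite -subr_le0 in y_le; apply: le_trans y_le.
  rewrite le_eqVlt; apply/orP; left; apply/eqP.
  rewrite !rmorphB !rmorphM /= !rmorphB /=; ring.
apply/negP; rewrite lt_geF //.
have v_pos : 0 < ((r - l) * (v *m v^T) 0 0)%:C%C.
  by rewrite ltcR mulr_gt0 // subr_gt0.
have x_pos : 0 < (q - l * (x *m x^T) 0 0)%:C%C by rewrite ltcR subr_gt0.
case: ab_neq0 => [a0|b0]; [apply: ltr_pwDl|apply: ltr_wpDl].
- by rewrite mulr_gt0 // exprn_gt0 // normr_gt0.
- by rewrite mulr_ge0 ?exprn_ge0 // ltW.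
- by rewrite mulr_ge0 ?exprn_ge0 // ltW.
- by rewrite mulr_gt0 // exprn_gt0 // normr_gt0.
Qed.

End Rayleigh.

(** * Expander mixing for sign vectors *)

Section Mixing.
Variables (R : realType) (n m d1 d2 : nat) (E : {set 'I_n * 'I_m}).
Hypothesis E_biregular : biregular d1 d2 E.

Let B : 'M[R]_(n, m) := \matrix_(i, j) ((i, j) \in E)%:R.

Lemma row_degree i : \sum_j B i j = d1%:R.
Proof.
rewrite -(E_biregular.1 i) -sum1_card natr_sum [RHS]big_mkcond /=.
by apply: eq_bigr => j _; rewrite mxE inE; case: (_ \in _).
Qed.

Lemma col_degree j : \sum_i B i j = d2%:R.
Proof.
rewrite -(E_biregular.2 j) -sum1_card natr_sum [RHS]big_mkcond /=.
by apply: eq_bigr => i _; rewrite mxE inE; case: (_ \in _).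
Qed.

Lemma edge_count : (n * d1 = m * d2)%N.
Proof.
apply/eqP; rewrite -(eqr_nat R) !natrM; apply/eqP.
have -> : n%:R * d1%:R = \sum_i \sum_j B i j.
  rewrite (eq_bigr (fun=> d1%:R)) => [|i _]; last exact: row_degree.
  by rewrite sumr_const card_ord mulr_natl.
rewrite exchange_big (eq_bigr (fun=> d2%:R)) => [|j _]; last exact: col_degree.
by rewrite sumr_const card_ord mulr_natl.
Qed.

Lemma adjmx_sym : (adjmx R E)^T = adjmx R E.
Proof. by rewrite /adjmx tr_block_mx !trmx0 trmxK. Qed.

Lemma adjmx_form (f : 'rV[R]_n) (g : 'rV[R]_m) :
  (row_mx f g *m adjmx R E *m (row_mx f g)^T) 0 0
  = 2 * \sum_i \sum_j B i j * (f 0 i * g 0 j).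
Proof.
rewrite /adjmx mul_row_block !mulmx0 add0r addr0 tr_row_mx mul_row_col.
have -> : g *m B^T *m f^T = f *m B *m g^T.
  have tr11 (M : 'M[R]_1) : M^T = M by apply/matrixP=> i j; rewrite mxE !ord1.
  by rewrite -[LHS]tr11 !trmx_mul !trmxK mulmxA.
rewrite mxE -[X in X + X]mul1r -mulrDl; congr (_ * _).
rewrite -mulmxA mxE; apply: eq_bigr => i _; rewrite mxE mulr_sumr.
by apply: eq_bigr => j _; rewrite !mxE; ring.
Qed.

(** The top eigenvector is constant on each side, so a vector that has mean zero
    on each side is orthogonal to it. *)
Lemma adjmx_perron :
  let v : 'rV[R]_(n + m) :=
    row_mx (const_mx (Num.sqrt d1%:R)) (const_mx (Num.sqrt d2%:R)) in
  v *m adjmx R E = Num.sqrt (d1 * d2)%:R *: v.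
Proof.
move=> v; have sq k : (Num.sqrt k%:R : R) ^+ 2 = k%:R by rewrite sqr_sqrtr.
rewrite /v /adjmx mul_row_block !mulmx0 add0r addr0 scale_row_mx.
rewrite natrM sqrtrM //; congr row_mx; apply/rowP=> i; rewrite !mxE.
  under eq_bigr do rewrite mxE mxE.
  by rewrite -mulr_sumr row_degree -[in LHS]sq; ring.
under eq_bigr do rewrite mxE.
by rewrite -mulr_sumr col_degree -[in LHS]sq; ring.
Qed.

Hypotheses (d1_gt0 : (0 < d1)%N) (d2_gt0 : (0 < d2)%N).

(** Over each edge, 2 f g <= (t / s) f^2 + (s / t) g^2 with s^2 = d1, t^2 = d2;
    the weights are those for which summing over the edges gives the same factor
    s t on both sides. So no eigenvalue exceeds sqrt (d1 d2). *)
Lemma edge_form_le (f : 'rV[R]_n) (g : 'rV[R]_m) :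
  2 * \sum_i \sum_j B i j * (f 0 i * g 0 j)
  <= Num.sqrt (d1 * d2)%:R * (\sum_i f 0 i ^+ 2 + \sum_j g 0 j ^+ 2).
Proof.
pose s : R := Num.sqrt d1%:R; pose t : R := Num.sqrt d2%:R.
have s_gt0 : 0 < s by rewrite sqrtr_gt0 ltr0n.
have t_gt0 : 0 < t by rewrite sqrtr_gt0 ltr0n.
have sE : s ^+ 2 = d1%:R by rewrite sqr_sqrtr.
have tE : t ^+ 2 = d2%:R by rewrite sqr_sqrtr.
rewrite natrM sqrtrM // -/s -/t.
have -> : s * t * (\sum_i f 0 i ^+ 2 + \sum_j g 0 j ^+ 2)
    = \sum_i \sum_j B i j * (t / s * f 0 i ^+ 2 + s / t * g 0 j ^+ 2).
  under [RHS]eq_bigr do under eq_bigr do rewrite mulrDr.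
  under [RHS]eq_bigr do rewrite big_split /=.
  rewrite big_split /= mulrDr; congr (_ + _).
    rewrite mulr_sumr; apply: eq_bigr => i _; rewrite -mulr_suml row_degree -sE.
    by field; rewrite gt_eqF.
  rewrite exchange_big mulr_sumr; apply: eq_bigr => j _ /=.
  rewrite -mulr_suml col_degree -tE.
  by field; rewrite gt_eqF.
rewrite mulr_sumr; apply: ler_sum => i _; rewrite mulr_sumr.
apply: ler_sum => j _; rewrite mulrCA; apply: ler_wpM2l.
  by rewrite mxE ler0n.
have -> : t / s * f 0 i ^+ 2 + s / t * g 0 j ^+ 2
    = 2 * (f 0 i * g 0 j) + (t * f 0 i - s * g 0 j) ^+ 2 / (s * t).
  by field; rewrite !gt_eqF.
by rewrite lerDl divr_ge0 ?sqr_ge0 // mulr_ge0 // ltW.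
Qed.

Variables (lambda eta : R).
Hypotheses (n_gt0 : (0 < n)%N) (m_gt0 : (0 < m)%N).
Hypothesis lambda_second : second_largest_eigenvalue (adjmx R E) lambda.
Hypotheses (lambda_le : lambda <= eta) (eta_ge0 : 0 <= eta).

(** A pair of mean-zero vectors is orthogonal to the top eigenvector, so the
    second eigenvalue controls it. *)
Lemma centered_form_le (f : 'rV[R]_n) (g : 'rV[R]_m) :
  \sum_i f 0 i = 0 -> \sum_j g 0 j = 0 ->
  2 * \sum_i \sum_j B i j * (f 0 i * g 0 j)
  <= eta * (\sum_i f 0 i ^+ 2 + \sum_j g 0 j ^+ 2).
Proof.
move=> f_sum g_sum; pose x := row_mx f g.
have xxE : (x *m x^T) 0 0 = \sum_i f 0 i ^+ 2 + \sum_j g 0 j ^+ 2.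
  rewrite /x tr_row_mx mul_row_col !mxE.
  by congr (_ + _); apply: eq_bigr => k _; rewrite mxE expr2.
rewrite -xxE -adjmx_form -/x.
have : (x *m adjmx R E *m x^T) 0 0 <= lambda * (x *m x^T) 0 0.
  apply: (rayleigh_le_second_eigenvalue adjmx_sym lambda_second adjmx_perron).
  - apply/eqP => /rowP/(_ (lshift m (Ordinal n_gt0))).
    rewrite row_mxEl !mxE => /eqP; rewrite sqrtr_eq0 leNgt ltr0n.
    by rewrite d1_gt0.
  - apply/matrixP=> i j; rewrite /x tr_row_mx mul_row_col !mxE (ord1 j).
    have -> : \sum_k (const_mx (Num.sqrt d1%:R) : 'rV[R]_n) i k * f^T k 0 = 0.
      by under eq_bigr do rewrite !mxE; rewrite -mulr_sumr f_sum mulr0.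
    under eq_bigr do rewrite !mxE.
    by rewrite -mulr_sumr g_sum mulr0 addr0.
  - by rewrite adjmx_form xxE edge_form_le.
move=> /le_trans; apply; apply: ler_wpM2r lambda_le.
by rewrite xxE addr_ge0 // sumr_ge0 // => k _; rewrite sqr_ge0.
Qed.

(** Normalizing f and g separately balances the two terms on the right of
    centered_form_le and turns their sum into a geometric mean. *)
Lemma centered_form_le_sqrt (f : 'rV[R]_n) (g : 'rV[R]_m) :
  \sum_i f 0 i = 0 -> \sum_j g 0 j = 0 ->
  \sum_i f 0 i ^+ 2 <= n%:R -> \sum_j g 0 j ^+ 2 <= m%:R ->
  \sum_i \sum_j B i j * (f 0 i * g 0 j) <= eta * Num.sqrt (n * m)%:R.
Proof.
move=> f_sum g_sum f_le g_le.
pose s : R := Num.sqrt n%:R; pose t : R := Num.sqrt m%:R.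
have s_gt0 : 0 < s by rewrite sqrtr_gt0 ltr0n.
have t_gt0 : 0 < t by rewrite sqrtr_gt0 ltr0n.
have sE : s ^+ 2 = n%:R by rewrite sqr_sqrtr.
have tE : t ^+ 2 = m%:R by rewrite sqr_sqrtr.
rewrite natrM sqrtrM // -/s -/t.
have := @centered_form_le (s^-1 *: f) (t^-1 *: g).
have scaled_sum k (c : R) (w : 'rV[R]_k) :
    \sum_i w 0 i = 0 -> \sum_i (c *: w) 0 i = 0.
  by move=> w0; under eq_bigr do rewrite mxE; rewrite -mulr_sumr w0 mulr0.
move=> /(_ (scaled_sum _ _ _ f_sum) (scaled_sum _ _ _ g_sum)).
have scaleE k (c : R) (w : 'rV[R]_k) i : (c *: w) 0 i = c * w 0 i.
  by rewrite mxE.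
under [X in 2 * X]eq_bigr do under eq_bigr do rewrite !scaleE.
under [X in _ <= _ * (X + _)]eq_bigr do rewrite scaleE exprMn.
under [X in _ <= _ * (_ + X)]eq_bigr do rewrite scaleE exprMn.
rewrite -!mulr_sumr.
have -> : \sum_i \sum_j B i j * (s^-1 * f 0 i * (t^-1 * g 0 j))
    = (s * t)^-1 * \sum_i \sum_j B i j * (f 0 i * g 0 j).
  rewrite mulr_sumr; apply: eq_bigr => i _; rewrite mulr_sumr.
  by apply: eq_bigr => j _; rewrite invfM; ring.
move=> form_le.
have norms_le : s^-1 ^+ 2 * (\sum_i f 0 i ^+ 2)
    + t^-1 ^+ 2 * (\sum_i g 0 i ^+ 2) <= 2.
  rewrite !exprVn sE tE -[2]/(1 + 1); apply: lerD.
    by rewrite mulrC ler_pdivrMr ?ltr0n // mul1r.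
  by rewrite mulrC ler_pdivrMr ?ltr0n // mul1r.
have := le_trans form_le (ler_wpM2l eta_ge0 norms_le).
rewrite (mulrC eta) ler_pM2l // mulrC ler_pdivrMr ?mulr_gt0 //.
Qed.

(** Expander mixing: the mean of a rank-one sign matrix over the edges is close
    to its mean over all entries. Subtracting the means of a and b leaves
    vectors that are orthogonal to the top eigenvector and no longer than a and
    b, and the cross terms vanish by biregularity. *)
Lemma sign_mixing (a : 'rV[R]_n) (b : 'rV[R]_m) :
  (forall i, a 0 i ^+ 2 = 1) -> (forall j, b 0 j ^+ 2 = 1) ->
  (n * d1)%:R^-1 * (\sum_i \sum_j B i j * (a 0 i * b 0 j))
  - (n * m)%:R^-1 * (\sum_i \sum_j a 0 i * b 0 j)
  <= eta / Num.sqrt (d1 * d2)%:R.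
Proof.
move=> a_sign b_sign.
have nR : (n%:R : R) != 0 by rewrite pnatr_eq0 -lt0n.
have mR : (m%:R : R) != 0 by rewrite pnatr_eq0 -lt0n.
have d1R : (d1%:R : R) != 0 by rewrite pnatr_eq0 -lt0n.
have d2R : (d2%:R : R) != 0 by rewrite pnatr_eq0 -lt0n.
pose abar := n%:R^-1 * \sum_i a 0 i; pose bbar := m%:R^-1 * \sum_j b 0 j.
pose f := a - const_mx abar; pose g := b - const_mx bbar.
have f_sum : \sum_i f 0 i = 0.
  under eq_bigr do rewrite !mxE.
  by rewrite sumrB sumr_const card_ord -mulr_natl mulVKf // subrr.
have g_sum : \sum_i g 0 i = 0.
  under eq_bigr do rewrite !mxE.
  by rewrite sumrB sumr_const card_ord -mulr_natl mulVKf // subrr.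
have f_le : \sum_i f 0 i ^+ 2 <= n%:R.
  have -> : \sum_i f 0 i ^+ 2 = n%:R - n%:R * abar ^+ 2.
    have fE i : f 0 i ^+ 2 = a 0 i ^+ 2 - 2 * abar * f 0 i - abar ^+ 2.
      by rewrite !mxE; ring.
    under eq_bigr do rewrite fE a_sign.
    by rewrite !sumrB -mulr_sumr f_sum !sumr_const !card_ord mulr_natl; ring.
  by rewrite lerBlDr lerDl mulr_ge0 // sqr_ge0.
have g_le : \sum_i g 0 i ^+ 2 <= m%:R.
  have -> : \sum_i g 0 i ^+ 2 = m%:R - m%:R * bbar ^+ 2.
    have gE i : g 0 i ^+ 2 = b 0 i ^+ 2 - 2 * bbar * g 0 i - bbar ^+ 2.
      by rewrite !mxE; ring.
    under eq_bigr do rewrite gE b_sign.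
    by rewrite !sumrB -mulr_sumr g_sum !sumr_const !card_ord mulr_natl; ring.
  by rewrite lerBlDr lerDl mulr_ge0 // sqr_ge0.
have edgeE : \sum_i \sum_j B i j * (a 0 i * b 0 j)
    = \sum_i \sum_j B i j * (f 0 i * g 0 j) + (n * d1)%:R * (abar * bbar).
  have split_ab i j : B i j * (a 0 i * b 0 j)
      = B i j * (f 0 i * g 0 j)
        + (f 0 i + abar) * bbar * B i j + abar * (B i j * g 0 j).
    by rewrite !mxE; ring.
  under eq_bigr do under eq_bigr do rewrite split_ab.
  under eq_bigr do rewrite !big_split /= -mulr_sumr row_degree.
  rewrite !big_split /= -!mulr_suml big_split /= f_sum sumr_const card_ord.
  rewrite exchange_big /= [X in _ + X]exchange_big /=.
  under [X in _ + X]eq_bigr do rewrite -mulr_sumr -mulr_suml col_degree.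
  rewrite -!mulr_sumr g_sum exchange_big natrM -mulr_natl; ring.
have meanE : \sum_i \sum_j a 0 i * b 0 j = (n * m)%:R * (abar * bbar).
  under eq_bigr do rewrite -mulr_sumr.
  by rewrite -mulr_suml natrM /abar /bbar; field; rewrite nR mR.
have ndR : (n * d1)%:R != 0 :> R by rewrite natrM mulf_neq0.
have nmR : (n * m)%:R != 0 :> R by rewrite natrM mulf_neq0.
rewrite edgeE meanE mulrDr !mulKf // addrK.
have := centered_form_le_sqrt f_sum g_sum f_le g_le.
have nd_pos : 0 < (n * d1)%:R :> R by rewrite ltr0n muln_gt0 n_gt0.
rewrite -(ler_pM2l (_ : 0 < (n * d1)%:R^-1)) ?invr_gt0 //.
move=> /le_trans; apply; rewrite mulrCA le_eqVlt; apply/orP; left; apply/eqP.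
congr (_ * _).
(* counting edges from both sides, (n d1)^2 = (n d1) (m d2) *)
have edge_sqrt : (n * d1)%:R = Num.sqrt (n * m)%:R * Num.sqrt (d1 * d2)%:R :> R.
  rewrite -sqrtrM // -natrM mulnACA -edge_count mulnn natrX sqrtr_sqr.
  by rewrite ger0_norm.
have s1 : Num.sqrt (n * m)%:R != 0 :> R.
  by rewrite sqrtr_eq0 -ltNge ltr0n muln_gt0 n_gt0.
have s2 : Num.sqrt (d1 * d2)%:R != 0 :> R.
  by rewrite sqrtr_eq0 -ltNge ltr0n muln_gt0 d1_gt0.
by rewrite edge_sqrt; field; rewrite s1 s2.
Qed.

End Mixing.

(** * Rotation invariance of the planar Gaussian measure *)

Section GaussianPlane.
Variable R : realType.
Local Open Scope classical_set_scope.
Local Open Scope ring_scope.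
Local Open Scope ereal_scope.
Local Notation mu := (@lebesgue_measure R).
Local Notation gauss := (@normal_prob R 0 1).
Local Notation T := (measurableTypeR R).

Lemma integral_translate (f : R -> \bar R) (a : R) :
  measurable_fun [set: R] f -> (forall x, 0 <= f x) ->
  \int[mu]_x f (x + a)%R = \int[mu]_x f x.
Proof.
move=> mf f0; pose t : T -> T := fun x => (x + a)%R.
have mt : measurable_fun [set: T] t by exact: measurable_funD.
have -> : \int[mu]_x f x = \int[pushforward mu t]_x f x.
  apply: eq_measure_integral => A mA _; apply: lebesgue_measure_unique => //.
  move=> _ [[x y]] _ <-; rewrite /=.
  rewrite /pushforward.
  rewrite (_ : t @^-1` _ = `](x - a)%R, (y - a)%R]%classic); last first.
    apply/seteqP; split=> z; rewrite /t /= !in_itv /=.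
      by rewrite ltrBlDr lerBrDr.
    by rewrite ltrBlDr lerBrDr.
  rewrite !lebesgue_measure_itv /= !lte_fin ltrD2r.
  by case: ifP => // _; rewrite -!EFinB; congr EFin; ring.
by rewrite ge0_integral_pushforward // preimage_setT.
Qed.

(** The Radon-Nikodym derivative of the Gaussian law is only determined almost
    everywhere; it agrees there with the explicit density because both have the
    same integrals over measurable sets. *)
Lemma integral_gauss (f : R -> \bar R) :
  measurable_fun [set: R] f -> (forall x, 0 <= f x) ->
  \int[gauss]_x f x = \int[mu]_x (f x * (normal_pdf 0 1 x)%:E).
Proof.
move=> mf f0; have dom : gauss `<< mu := normal_prob_dominates 0 1.
have mpdf : measurable_fun [set: R] (fun x : R => (normal_pdf 0 1 x)%:E).
  by apply/measurable_EFinP; exact: measurable_normal_pdf.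
have := Radon_Nikodym_SigmaFinite.f_integrable dom.
set g := Radon_Nikodym_SigmaFinite.f _ _ => ig.
rewrite -(Radon_Nikodym_SigmaFinite.change_of_variables dom f0 measurableT mf).
apply: ae_eq_integral => //.
- by apply: emeasurable_funM => //; exact: measurable_int ig.
- exact: emeasurable_funM.
apply: ae_eqe_mul2l; apply: integral_ae_eq => // A _ mA.
by rewrite -(Radon_Nikodym_SigmaFinite.f_integral dom).
Qed.

Lemma measurable_fun_affine d (S : measurableType d) (f g : S -> R) (a b : R) :
  measurable_fun [set: S] f -> measurable_fun [set: S] g ->
  measurable_fun [set: S] (fun z => a * f z + b * g z)%R.
Proof.
by move=> mf mg; apply: measurable_funD; apply: measurable_funM.
Qed.

Lemma measurable_fun_planar d (S : measurableType d) (H : T * T -> \bar R)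
    (f g : S -> R) :
  measurable_fun [set: T * T] H ->
  measurable_fun [set: S] f -> measurable_fun [set: S] g ->
  measurable_fun [set: S] (fun z => H (f z, g z)).
Proof.
move=> mH mf mg; apply: measurableT_comp mH _.
exact: measurable_fun_pair.
Qed.

Lemma shear_fst (H : T * T -> \bar R) (t : R) :
  measurable_fun [set: T * T] H -> (forall z, 0 <= H z) ->
  \int[mu]_x \int[mu]_y H (x + t * y, y)%R = \int[mu]_x \int[mu]_y H (x, y).
Proof.
move=> mH H0.
rewrite (fubini_tonelli (fun z : T * T => H (z.1 + t * z.2, z.2)%R)) //=.
  rewrite (fubini_tonelli H) //; apply: eq_integral => y _.
  apply: (integral_translate (f := fun x => H (x, y))) => //.
  exact: measurable_fun_planar.
apply: measurable_fun_planar => //.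
by apply: measurable_funD => //; apply: measurable_funM.
Qed.

Lemma shear_snd (H : T * T -> \bar R) (t : R) :
  measurable_fun [set: T * T] H -> (forall z, 0 <= H z) ->
  \int[mu]_x \int[mu]_y H (x, y + t * x)%R = \int[mu]_x \int[mu]_y H (x, y).
Proof.
move=> mH H0; apply: eq_integral => x _.
apply: (integral_translate (f := fun y => H (x, y))) => //.
exact: measurable_fun_planar.
Qed.

(** A rotation other than the half turn is a product of three shears, the outer
    ones with slope t = tan (angle / 2) = s / (1 + c), and a shear preserves the
    plane measure by Fubini and invariance under translations. *)
Lemma lebesgue_rotation (H : T * T -> \bar R) (c s : R) :
  measurable_fun [set: T * T] H -> (forall z, 0 <= H z) ->
  (c ^+ 2 + s ^+ 2 = 1)%R -> (1 + c != 0)%R ->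
  \int[mu]_x \int[mu]_y H (c * x - s * y, s * x + c * y)%R
  = \int[mu]_x \int[mu]_y H (x, y).
Proof.
move=> mH H0 cs1 c1; pose t := (s / (1 + c))%R.
have tc : (t * (1 + c) = s)%R by rewrite /t divfK.
have ts : (t * s = 1 - c)%R.
  apply: (mulIf c1); rewrite mulrAC tc -expr2.
  have -> : (s ^+ 2 = 1 - c ^+ 2)%R by rewrite -cs1; ring.
  ring.
pose K1 z := H (z.1 + - t * z.2, z.2)%R.
pose K2 z := K1 (z.1, z.2 + s * z.1)%R.
have mK1 : measurable_fun [set: T * T] K1.
  apply: measurable_fun_planar => //.
  by apply: measurable_funD => //; apply: measurable_funM.
have mK2 : measurable_fun [set: T * T] K2.
  apply: measurable_fun_planar => //.
  by apply: measurable_funD => //; apply: measurable_funM.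
rewrite -(shear_fst (- t) mH) // -(shear_snd s mK1) => [|z]; last exact: H0.
rewrite -(shear_fst (- t) mK2) => [|z]; last exact: H0.
apply: eq_integral => x _; apply: eq_integral => y _.
rewrite /K2 /K1 /=; congr (H (_, _)).
  transitivity (x - t * s * x - t * (1 + (1 - t * s)) * y)%R; last by ring.
  by rewrite ts (_ : 1 + (1 - (1 - c)) = 1 + c)%R ?tc; ring.
transitivity (s * x + (1 - t * s) * y)%R; last by ring.
by rewrite ts; ring.
Qed.

(** The product density depends only on x^2 + y^2. *)
Lemma gauss_rotation_aux (H : T * T -> \bar R) (c s : R) :
  measurable_fun [set: T * T] H -> (forall z, 0 <= H z) ->
  (c ^+ 2 + s ^+ 2 = 1)%R -> (1 + c != 0)%R ->
  \int[gauss]_x \int[gauss]_y H (c * x - s * y, s * x + c * y)%R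
  = \int[gauss]_x \int[gauss]_y H (x, y).
Proof.
move=> mH H0 cs1 c1.
pose p (x : R) : R := normal_pdf 0 1 x.
have p_ge0 x : (0 <= p x)%R by exact: normal_pdf_ge0.
have mp : measurable_fun [set: T] p by exact: measurable_normal_pdf.
have pE x : p x = (normal_peak 1 * expR (- x ^+ 2 / 2))%R.
  by rewrite /p normal_pdfE ?oner_neq0 // /normal_fun subr0 expr1n.
have density (K : T * T -> \bar R) :
    measurable_fun [set: T * T] K -> (forall z, 0 <= K z) ->
    \int[gauss]_x \int[gauss]_y K (x, y)
    = \int[mu]_x \int[mu]_y (K (x, y) * (p x * p y)%:E).
  move=> mK K0; rewrite integral_gauss; first last.
  - by move=> x; exact: integral_ge0.
  - exact: (measurable_fun_fubini_tonelli_F K).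
  apply: eq_integral => x _; rewrite integral_gauss //; last first.
    exact: measurable_fun_planar.
  rewrite -ge0_integralZr //.
  - by apply: eq_integral => y _; rewrite EFinM -muleA [(_ * (p x)%:E)]muleC.
  - apply: emeasurable_funM; first exact: measurable_fun_planar.
    exact/measurable_EFinP.
  - by move=> y _; rewrite mule_ge0 // lee_fin.
  - by rewrite lee_fin.
have mrot1 : measurable_fun [set: T * T] (fun z : T * T => c * z.1 - s * z.2)%R.
  by apply: measurable_funB => //; apply: measurable_funM.
have mrot2 : measurable_fun [set: T * T] (fun z : T * T => s * z.1 + c * z.2)%R.
  by apply: measurable_funD => //; apply: measurable_funM.
rewrite (density (fun z => H (c * z.1 - s * z.2, s * z.1 + c * z.2)%R)) //;
  last exact: measurable_fun_planar.
rewrite (density H mH H0).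
rewrite -(lebesgue_rotation (H := fun z => H z * (p z.1 * p z.2)%:E)
           _ _ cs1 c1).
- apply: eq_integral => x _; apply: eq_integral => y _ /=; congr (_ * _%:E).
  rewrite !pE mulrACA [in RHS]mulrACA -!expRD; congr (_ * expR _)%R.
  transitivity (- ((c ^+ 2 + s ^+ 2) * (x ^+ 2 + y ^+ 2)) / 2)%R; last by ring.
  by rewrite cs1; ring.
- apply: emeasurable_funM => //; apply/measurable_EFinP.
  by apply: measurable_funM; apply: measurableT_comp mp _.
- by move=> z; rewrite mule_ge0 // lee_fin mulr_ge0.
Qed.

Lemma gauss_rotation (H : T * T -> \bar R) (c s : R) :
  measurable_fun [set: T * T] H -> (forall z, 0 <= H z) ->
  (c ^+ 2 + s ^+ 2 = 1)%R ->
  \int[gauss]_x \int[gauss]_y H (c * x - s * y, s * x + c * y)%R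
  = \int[gauss]_x \int[gauss]_y H (x, y).
Proof.
move=> mH H0 cs1.
have [c1|] := eqVneq (1 + c)%R 0%R; last exact: gauss_rotation_aux.
(* the half turn is the square of a quarter turn *)
have cE : c = (-1)%R by apply/eqP; rewrite -addr_eq0 addrC c1.
have s0 : s = 0%R.
  apply/eqP; rewrite -sqrf_eq0; apply/eqP; apply: (addrI (c ^+ 2)%R).
  by rewrite cs1 cE; ring.
have quarter (K : T * T -> \bar R) :
    measurable_fun [set: T * T] K -> (forall z, 0 <= K z) ->
    \int[gauss]_x \int[gauss]_y K (0 * x - 1 * y, 1 * x + 0 * y)%R
    = \int[gauss]_x \int[gauss]_y K (x, y).
  move=> mK K0; apply: gauss_rotation_aux => //.
  by ring.
pose H1 (z : T * T) := H (0 * z.1 - 1 * z.2, 1 * z.1 + 0 * z.2)%R.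
have mH1 : measurable_fun [set: T * T] H1.
  apply: measurable_fun_planar => //.
    by apply: measurable_funB => //; apply: measurable_funM.
  by apply: measurable_funD => //; apply: measurable_funM.
rewrite -(quarter H mH H0) -(quarter H1 mH1 (fun z => H0 _)).
apply: eq_integral => x _; apply: eq_integral => y _ /=.
by rewrite /H1 /=; congr (H (_, _)); rewrite cE s0; ring.
Qed.

(** Rotation invariance, read on the coefficients of a pair of linear forms
    instead of on the variables. *)
Lemma gauss_rotation_coef (H : T * T -> \bar R) (c s : R) (z w : R * R) :
  measurable_fun [set: T * T] H -> (forall z, 0 <= H z) ->
  (c ^+ 2 + s ^+ 2 = 1)%R ->
  \int[gauss]_x \int[gauss]_y H (z.1 * x + w.1 * y, z.2 * x + w.2 * y)%R
  = \int[gauss]_x \int[gauss]_y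
      H ((z.1 * c + w.1 * s) * x + (w.1 * c - z.1 * s) * y,
         (z.2 * c + w.2 * s) * x + (w.2 * c - z.2 * s) * y)%R.
Proof.
move=> mH H0 cs1.
pose K (t : T * T) := H (z.1 * t.1 + w.1 * t.2, z.2 * t.1 + w.2 * t.2)%R.
have mK : measurable_fun [set: T * T] K.
  by apply: measurable_fun_planar => //; apply: measurable_fun_affine.
rewrite -(gauss_rotation mK (fun t => H0 _) cs1).
apply: eq_integral => x _; apply: eq_integral => y _ /=.
by rewrite /K /=; congr (H (_, _)); ring.
Qed.

Lemma gauss_radial (F : T -> \bar R) (p q p' q' : R) :
  measurable_fun [set: T] F -> (forall x, 0 <= F x) ->
  (p ^+ 2 + q ^+ 2 = p' ^+ 2 + q' ^+ 2)%R ->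
  \int[gauss]_x \int[gauss]_y F (p * x + q * y)%R
  = \int[gauss]_x \int[gauss]_y F (p' * x + q' * y)%R.
Proof.
move=> mF F0 pq.
have [r0|r0] := eqVneq (p ^+ 2 + q ^+ 2)%R 0%R.
  have zero (u v : R) : (u ^+ 2 + v ^+ 2 = 0 -> u = 0 /\ v = 0)%R.
    move=> /eqP; rewrite paddr_eq0 ?sqr_ge0 // !sqrf_eq0.
    by move=> /andP[/eqP-> /eqP->].
  have [-> ->] := zero _ _ r0.
  by have [-> ->] := zero _ _ (etrans (esym pq) r0).
(* the rotation that carries the vector (p, q) to (p', q') *)
pose c := ((p * p' + q * q') / (p ^+ 2 + q ^+ 2))%R.
pose s := ((q * p' - p * q') / (p ^+ 2 + q ^+ 2))%R.
have cs1 : (c ^+ 2 + s ^+ 2 = 1)%R.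
  rewrite /c /s !expr_div_n -mulrDl.
  have -> : ((p * p' + q * q') ^+ 2 + (q * p' - p * q') ^+ 2
            = (p ^+ 2 + q ^+ 2) * (p' ^+ 2 + q' ^+ 2))%R by ring.
  by rewrite -pq -expr2 divff // expf_neq0.
have mF1 : measurable_fun [set: T * T] (fun z => F z.1).
  exact: measurableT_comp.
rewrite (gauss_rotation_coef (p, 0%R) (q, 0%R) mF1 (fun z => F0 _) cs1) /=.
apply: eq_integral => x _; apply: eq_integral => y _; congr F.
by congr (_ * _ + _ * _)%R; rewrite /c /s; field.
Qed.

End GaussianPlane.

(** * Gaussian vectors in every dimension *)

Section GaussianProcess.
Variable R : realType.
Local Open Scope classical_set_scope.
Local Open Scope ring_scope.
Local Open Scope ereal_scope.
Local Notation gauss := (@normal_prob R 0 1).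
Local Notation T := (measurableTypeR R).

(** The joint law of X and Y is that of the linear forms a x and b x + c y in
    two independent standard Gaussian variables. Testing against nonnegative
    functions keeps all integrals defined. *)
Definition gaussian_pair_law d (S : measurableType d) (P : probability S R)
    (X Y : S -> R) (a b c : R) :=
  forall H : T * T -> \bar R,
    measurable_fun [set: T * T] H -> (forall z, 0 <= H z) ->
    \int[P]_t H (X t, Y t)
    = \int[gauss]_x \int[gauss]_y H (a * x, b * x + c * y)%R.

(** The Cholesky factor of the Gram matrix of u and v. *)
Lemma planar_gram (k : nat) (u v : 'I_k -> R) :
  exists a b c : R, [/\ (a ^+ 2 = \sum_i u i ^+ 2)%R,
    (a * b = \sum_i u i * v i)%R & (b ^+ 2 + c ^+ 2 = \sum_i v i ^+ 2)%R].
Proof.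
have sq_ge0 (w : 'I_k -> R) : (0 <= \sum_i w i ^+ 2)%R.
  by apply: sumr_ge0 => i _; rewrite sqr_ge0.
have CS := cauchy_schwarz u v.
exists (Num.sqrt (\sum_i u i ^+ 2)).
have aE : (Num.sqrt (\sum_i u i ^+ 2) ^+ 2 = \sum_i u i ^+ 2)%R.
  by rewrite sqr_sqrtr.
set a := Num.sqrt _ in aE *; rewrite -aE in CS *.
have [a0|a0] := eqVneq a 0%R.
  exists 0%R, (Num.sqrt (\sum_i v i ^+ 2)); split=> //.
    rewrite mulr0; apply/esym/eqP; rewrite -sqrf_eq0 eq_le sqr_ge0 andbT.
    by apply: le_trans CS _; rewrite a0 expr0n mul0r.
  by rewrite expr0n add0r sqr_sqrtr.
exists ((\sum_i u i * v i) / a)%R.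
exists (Num.sqrt (\sum_i v i ^+ 2 - ((\sum_i u i * v i) / a) ^+ 2)).
split=> //; first by rewrite mulrC divfK.
rewrite sqr_sqrtr ?subrKC // subr_ge0 expr_div_n ler_pdivrMr.
  by rewrite mulrC.
by rewrite lt_neqAle eq_sym expf_neq0 // sqr_ge0.
Qed.

(** Independent standard Gaussian variables, with the statement that the joint
    law of two linear forms depends only on the Gram matrix of their
    coefficients. A new coordinate adds a third variable to the planar model of
    the forms in the old coordinates. Two rotations remove it: one clears the
    second variable from the first form, the other merges the remaining two
    variables of the second form. *)
Lemma gaussian_process (k : nat) :
  exists d (S : measurableType d) (P : probability S R) (g : 'I_k -> S -> R),
    (forall i, measurable_fun [set: S] (g i)) /\
    forall (u v : 'I_k -> R) (a b c : R),
      (a ^+ 2 = \sum_i u i ^+ 2)%R -> (a * b = \sum_i u i * v i)%R ->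
      (b ^+ 2 + c ^+ 2 = \sum_i v i ^+ 2)%R ->
      gaussian_pair_law P (fun t => \sum_i u i * g i t)%R
        (fun t => \sum_i v i * g i t)%R a b c.
Proof.
elim: k => [|k [d [S [P [g [mg gP]]]]]].
  exists _, T, [the probability T R of gauss], (fun=> cst 0%R).
  split=> [[]//|u v a b c].
  rewrite !big_ord0 => /eqP; rewrite sqrf_eq0 => /eqP-> _ /eqP.
  rewrite paddr_eq0 ?sqr_ge0 // !sqrf_eq0 => /andP[/eqP-> /eqP->] H mH H0.
  apply: eq_integral => x _.
  under eq_integral do rewrite !mul0r addr0.
  rewrite integral_cst // [X in _ * X]probability_setT mule1.
  by rewrite !big_ord0.
exists _, (T * S)%type, [the probability (T * S)%type R of (gauss \x P)].
exists (fun i t => if unlift ord0 i is Some j then g j t.2 else t.1).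
split=> [i|u v a b c aE bE cE H mH H0].
  case: (unlift ord0 i) => [j|] //; exact: measurableT_comp.
pose u0 := u ord0; pose v0 := v ord0.
pose u' i := u (lift ord0 i); pose v' i := v (lift ord0 i).
rewrite !big_ord_recl in aE bE cE.
have [a' [b' [c' [a'E b'E c'E]]]] := planar_gram u' v'.
have msum (w : 'I_k -> R) :
    measurable_fun [set: S] (fun t => \sum_i w i * g i t)%R.
  by apply: measurable_sum => i; apply: measurable_funM.
transitivity (\int[gauss]_x \int[gauss]_y \int[gauss]_z
    H (u0 * x + a' * y, v0 * x + (b' * y + c' * z))%R).
  transitivity (\int[gauss \x P]_t
      H (u0 * t.1 + \sum_i u' i * g i t.2, v0 * t.1 + \sum_i v' i * g i t.2)%R).
    apply: eq_integral => t _; rewrite !big_ord_recl unlift_none.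
    by congr (H (_ + _, _ + _)%R); apply: eq_bigr => i _; rewrite liftK.
  rewrite (fubini_tonelli1 (fun t : T * S =>
    H (u0 * t.1 + \sum_i u' i * g i t.2,
       v0 * t.1 + \sum_i v' i * g i t.2)%R)) //=.
    apply: eq_integral => x _; rewrite /fubini_F /=.
    apply: (gP _ _ _ _ _ a'E b'E c'E
              (fun w => H (u0 * x + w.1, v0 * x + w.2)%R)) => //.
    by apply: measurable_fun_planar => //; apply: measurable_funD.
  apply: measurable_fun_planar => //; apply: measurable_funD;
    by [apply: measurable_funM | apply: measurableT_comp (msum _) _].
have mrow p : measurable_fun [set: T] (fun q : T => H (p, q)).
  exact: measurable_fun_planar.
(* if a = 0 then b is not determined by the Gram matrix, but the first form
   vanishes and only b^2 + c^2 matters *)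
have [a0|a0] := eqVneq a 0%R.
  have [u00 a'0] : u0 = 0%R /\ a' = 0%R.
    move/esym/eqP: aE; rewrite a0 expr0n /= -/u0 -a'E.
    by rewrite paddr_eq0 ?sqr_ge0 // !sqrf_eq0 => /andP[/eqP-> /eqP->].
  pose f := Num.sqrt (b' ^+ 2 + c' ^+ 2).
  have fE : (f ^+ 2 = b' ^+ 2 + c' ^+ 2)%R.
    by rewrite sqr_sqrtr // addr_ge0 // sqr_ge0.
  transitivity (\int[gauss]_x \int[gauss]_y H (0, v0 * x + f * y)%R).
    apply: eq_integral => x _; rewrite u00 a'0.
    transitivity (\int[gauss]_y \int[gauss]_z
                    H (0, v0 * x + (b' * y + c' * z))%R).
      apply: eq_integral => y _; apply: eq_integral => z _.
      by rewrite !mul0r addr0.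
    rewrite (gauss_radial (F := fun q => H (0, v0 * x + q)%R) (p' := f)
               (q' := 0%R)) //.
    - apply: eq_integral => y _; under eq_integral do rewrite mul0r addr0.
      by rewrite integral_cst // [X in _ * X]probability_setT mule1.
    - by apply: measurable_fun_planar => //; apply: measurable_funD.
    - by rewrite expr0n addr0 fE.
  rewrite (gauss_radial (F := fun q => H (0%R, q)) (p' := b) (q' := c)) //.
    by apply: eq_integral => x _; apply: eq_integral => y _; rewrite a0 mul0r.
  by rewrite cE fE c'E.
pose H2 (w : T * T) := \int[gauss]_z H (w.1, w.2 + c' * z)%R.
have mH2 : measurable_fun [set: T * T] H2.
  apply: (measurable_fun_fubini_tonelli_F
            (fun t : (T * T) * T => H (t.1.1, t.1.2 + c' * t.2)%R)) => //.
  apply: measurable_fun_planar => //.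
    exact: measurableT_comp measurable_fst _.
  apply: measurable_funD; first exact: measurableT_comp measurable_snd _.
  exact: measurable_funM.
have H2_ge0 w : 0 <= H2 w by exact: integral_ge0.
pose c1 := (u0 / a)%R; pose s1 := (a' / a)%R.
have cs1 : (c1 ^+ 2 + s1 ^+ 2 = 1)%R.
  by rewrite !expr_div_n -mulrDl a'E /u0 -aE divff // expf_neq0.
transitivity (\int[gauss]_x \int[gauss]_y
                H2 (u0 * x + a' * y, v0 * x + b' * y)%R).
  apply: eq_integral => x _; apply: eq_integral => y _.
  by rewrite /H2; apply: eq_integral => z _ /=; rewrite addrA.
rewrite (gauss_rotation_coef (u0, v0) (a', b') mH2 H2_ge0 cs1) /=.
apply: eq_integral => x _.
have -> : (u0 * c1 + a' * s1 = a)%R.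
  transitivity ((u0 ^+ 2 + a' ^+ 2) / a)%R; first by rewrite /c1 /s1; field.
  by rewrite a'E /u0 -aE expr2 mulfK.
have -> : (a' * c1 - u0 * s1 = 0)%R by rewrite /c1 /s1; field.
have bE' : (v0 * c1 + b' * s1 = b)%R.
  transitivity ((u0 * v0 + a' * b') / a)%R; first by rewrite /c1 /s1; field.
  by rewrite b'E /u0 /v0 -bE mulrAC divff // mul1r.
rewrite bE'; set e := (b' * c1 - v0 * s1)%R.
transitivity (\int[gauss]_y \int[gauss]_z
                H (a * x, b * x + (e * y + c' * z))%R).
  apply: eq_integral => y _; rewrite /H2; apply: eq_integral => z _ /=.
  by rewrite mul0r addr0 addrA.
rewrite (gauss_radial (F := fun q => H (a * x, b * x + q)%R) (p' := c)
           (q' := 0%R)) //.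
- apply: eq_integral => y _; under eq_integral do rewrite mul0r addr0.
  by rewrite integral_cst // [X in _ * X]probability_setT mule1.
- by apply: measurable_fun_planar => //; apply: measurable_funD.
apply: (addrI (b ^+ 2)%R); rewrite expr0n addr0 cE -c'E -/v0 addrA addrA.
congr (_ + _)%R; rewrite -bE' /e.
transitivity ((c1 ^+ 2 + s1 ^+ 2) * (v0 ^+ 2 + b' ^+ 2))%R; first by ring.
by rewrite cs1 mul1r.
Qed.

End GaussianProcess.

(** * Sign disagreement and angles *)

(** Writing x as k steps of length L / n and a remainder below one step shows
    that f x is within f L / n of the linear value, for every n. *)
Lemma additive_nonneg_linear (R : realType) (f : R -> R) (L : R) :
  0 < L -> (forall x, 0 <= x <= L -> 0 <= f x) ->
  (forall x y, 0 <= x -> 0 <= y -> x + y <= L -> f (x + y) = f x + f y) ->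
  forall x, 0 <= x <= L -> f x = x / L * f L.
Proof.
move=> L_gt0 f_ge0 fD x /andP[x_ge0 xL].
have f0 : f 0 = 0.
  by apply: (addrI (f 0)); rewrite -fD ?addr0 // ltW.
have f_mulrn h k : 0 <= h -> h *+ k <= L -> f (h *+ k) = f h *+ k.
  move=> h_ge0; elim: k => [|k IHk] hkL; first by rewrite !mulr0n.
  rewrite !mulrSr in hkL *; rewrite fD ?mulrn_wge0 // IHk //.
  by apply: le_trans hkL; rewrite lerDl.
have close n : (0 < n)%N -> `|f x - x / L * f L| <= f L / n%:R.
  move=> n_gt0; have nR : 0 < n%:R :> R by rewrite ltr0n.
  pose h := L / n%:R; have h_gt0 : 0 < h by rewrite divr_gt0.
  have hn : h *+ n = L by rewrite -mulr_natr /h divfK // gt_eqF.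
  have fh : f h = f L / n%:R.
    rewrite -hn (f_mulrn h n) ?hn ?lexx ?(ltW h_gt0) // -[_ *+ n]mulr_natr.
    by rewrite mulfK // gt_eqF.
  pose k := Num.truncn (x / h); pose r := x - h *+ k.
  have /andP[kx xk] : k%:R <= x / h < k.+1%:R.
    by apply: Num.Theory.truncn_itv; rewrite divr_ge0 // ltW.
  have r_ge0 : 0 <= r by rewrite subr_ge0 -mulr_natl -ler_pdivlMr.
  have r_le : r <= h.
    by rewrite lerBlDl -mulrSr -mulr_natl -ler_pdivrMr // ltW.
  have xE : x = h *+ k + r by rewrite subrKC.
  have kL : h *+ k <= L by apply: le_trans xL; rewrite [x in leRHS]xE lerDl.
  have hL : h <= L.
    by rewrite /h ler_pdivrMr // ler_peMr ?ler1n // ltW.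
  have fx : f x = f h *+ k + f r.
    have := fD (h *+ k) r (mulrn_wge0 k (ltW h_gt0)) r_ge0.
    by rewrite -xE => -> //; rewrite f_mulrn // ltW.
  have fr_ge0 : 0 <= f r by rewrite f_ge0 // r_ge0 (le_trans r_le).
  have fr_le : f r <= f h.
    have hr_ge0 : 0 <= h - r by rewrite subr_ge0.
    have := fD r (h - r) r_ge0 hr_ge0; rewrite subrKC => -> //.
    by rewrite lerDl f_ge0 // hr_ge0 (le_trans _ hL) // gerBl.
  have -> : f x - x / L * f L = f r - r / L * f L.
    have hk : h *+ k / L * f L = f h *+ k.
      rewrite !mulrnAl fh /h; congr (_ *+ _).
      by field; rewrite !gt_eqF.
    by rewrite fx [in x / L]xE mulrDl mulrDl hk opprD addrACA subrr add0r.
  have fL_ge0 : 0 <= f L by rewrite f_ge0 // lexx ltW.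
  have rL_ge0 : 0 <= r / L * f L by rewrite mulr_ge0 // divr_ge0 // ltW.
  have rL_le : r / L * f L <= f L / n%:R.
    rewrite [leRHS]mulrC ler_wpM2r // ler_pdivrMr // mulrC -/h.
    exact: r_le.
  rewrite ler_norml; apply/andP; split; last first.
    by rewrite lerBlDr (le_trans fr_le) // fh lerDl.
  by rewrite lerBrDr (le_trans _ fr_ge0) // addrC subr_le0.
apply/eqP; rewrite -subr_eq0 -normr_le0 leNgt; apply/negP => d_gt0.
set d := `|_| in close d_gt0.
pose n := (Num.truncn (f L / d)).+1.
have /close : (0 < n)%N by [].
rewrite leNgt ltr_pdivrMr ?ltr0n // mulrC -ltr_pdivrMr // truncnS_gt //.
Qed.

Section Wedge.
Variable R : realType.
Local Open Scope classical_set_scope.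
Local Open Scope ring_scope.
Local Open Scope ereal_scope.
Local Notation gauss := (@normal_prob R 0 1).
Local Notation T := (measurableTypeR R).

(** The sign of 0 is taken to be positive, so that rounding always yields a
    sign. *)
Definition sign_differ (x y : R) : R := ((0 <= x)%R != (0 <= y)%R)%:R.

Lemma sign_differ_ge0 x y : (0 <= sign_differ x y)%R.
Proof. by rewrite /sign_differ ler0n. Qed.

Lemma measurable_sign_differ d (S : measurableType d) (f g : S -> R) :
  measurable_fun [set: S] f -> measurable_fun [set: S] g ->
  measurable_fun [set: S] (fun z => sign_differ (f z) (g z)).
Proof.
move=> mf mg; have m0 (h : S -> R) : measurable_fun [set: S] h ->
    measurable_fun [set: S] (fun z => 0 <= h z)%R.
  by move=> mh; apply: measurable_fun_ler.
apply: (measurableT_comp (f := fun b : bool => b%:R : R)) => //.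
have -> : (fun z => (0 <= f z)%R != (0 <= g z)%R)
    = (fun z => ((0 <= f z) && ~~ (0 <= g z))
                || (~~ (0 <= f z) && (0 <= g z)))%R.
  by apply/funext => z; case: (0 <= f z)%R; case: (0 <= g z)%R.
apply: measurable_or; apply: measurable_and; rewrite ?measurable_neg //;
  try exact: m0; by apply: measurable_neg; exact: m0.
Qed.

(** The line x = 0 is where the conventions about the sign of 0 are felt; it is
    a null set. *)
Lemma gauss_iterated_ae (H K : T * T -> \bar R) :
  measurable_fun [set: T * T] H -> (forall z, 0 <= H z) ->
  measurable_fun [set: T * T] K -> (forall z, 0 <= K z) ->
  (forall x y, x != 0%R -> H (x, y) = K (x, y)) ->
  \int[gauss]_x \int[gauss]_y H (x, y) = \int[gauss]_x \int[gauss]_y K (x, y).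
Proof.
move=> mH H0 mK K0 HK; apply: ge0_ae_eq_integral => //.
- exact: (measurable_fun_fubini_tonelli_F H).
- exact: (measurable_fun_fubini_tonelli_F K).
- by move=> x _; exact: integral_ge0.
- by move=> x _; exact: integral_ge0.
exists [set 0%R]; split => //.
  by rewrite /= /normal_prob integral_set1.
move=> x /= Hx; apply: contrapT => x0. apply: Hx => _.
have {}x0 : x != 0%R by apply/eqP.
by apply: eq_integral => y _; exact: HK.
Qed.

Lemma gauss_iteratedD (H K : T * T -> \bar R) :
  measurable_fun [set: T * T] H -> (forall z, 0 <= H z) ->
  measurable_fun [set: T * T] K -> (forall z, 0 <= K z) ->
  \int[gauss]_x \int[gauss]_y (H (x, y) + K (x, y))
  = \int[gauss]_x \int[gauss]_y H (x, y) + \int[gauss]_x \int[gauss]_y K (x, y).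
Proof.
move=> mH H0 mK K0.
have mrow (G : T * T -> \bar R) x : measurable_fun [set: T * T] G ->
    measurable_fun [set: T] (fun y : T => G (x, y)).
  by move=> mG; exact: measurable_fun_planar.
rewrite -ge0_integralD //.
- by apply: eq_integral => x _; rewrite ge0_integralD //; exact: mrow.
- by move=> x _; exact: integral_ge0.
- exact: (measurable_fun_fubini_tonelli_F H).
- by move=> x _; exact: integral_ge0.
- exact: (measurable_fun_fubini_tonelli_F K).
Qed.

Definition side (t x y : R) : R := (cos t * x + sin t * y)%R.

(** The Gaussian measure of the double wedge between the lines that are normal
    to the directions at angles t and s. *)
Definition wedge (t s : R) : \bar R :=
  \int[gauss]_x \int[gauss]_y (sign_differ (side t x y) (side s x y))%:E.

Let measurable_wedge t s : measurable_fun [set: T * T]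
  (fun z : T * T => (sign_differ (side t z.1 z.2) (side s z.1 z.2))%:E).
Proof.
apply/measurable_EFinP; apply: measurable_sign_differ;
  exact: measurable_fun_affine.
Qed.

Let wedge_fun_ge0 t s (z : T * T) :
  0 <= (sign_differ (side t z.1 z.2) (side s z.1 z.2))%:E.
Proof. by rewrite lee_fin sign_differ_ge0. Qed.

Lemma wedge_ge0 t s : 0 <= wedge t s.
Proof.
apply: integral_ge0 => x _; apply: integral_ge0 => y _.
exact: (wedge_fun_ge0 t s (x, y)).
Qed.

Lemma wedge_rotation (a t s : R) : wedge (t + a) (s + a) = wedge t s.
Proof.
rewrite /wedge -(gauss_rotation (measurable_wedge t s) (wedge_fun_ge0 t s)
  (c := cos (- a)) (s := sin (- a))); last by rewrite cos2Dsin2.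
apply: eq_integral => x _; apply: eq_integral => y _ /=.
have sideD r : side (r + a) x y
    = side r (cos (- a) * x - sin (- a) * y) (sin (- a) * x + cos (- a) * y).
  by rewrite /side cosD sinD cosN sinN; ring.
by rewrite !sideD.
Qed.

Lemma wedge_straight : wedge 0 pi = 1.
Proof.
rewrite /wedge (gauss_iterated_ae (measurable_wedge 0 pi) (wedge_fun_ge0 0 pi)
  (K := cst 1)) //=.
  have int1 : \int[gauss]_x cst 1 x = 1.
    by rewrite integral_cst // [X in _ * X]probability_setT mule1.
  by rewrite -[RHS]int1; apply: eq_integral => x _; exact: int1.
move=> x y x0; rewrite /side cos0 sin0 cospi sinpi !mul0r !addr0 mul1r mulN1r.
rewrite /sign_differ oppr_ge0; case: ltgtP x0 => // _ _.
Qed.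

(** Directions at angles 0, a, a + b with a + b <= pi come in this order around
    a half plane, so a point that separates the outer two separates exactly one
    of the consecutive pairs. *)
Lemma wedge_additive (a b : R) : (0 <= a)%R -> (0 <= b)%R -> (a + b <= pi)%R ->
  wedge 0 (a + b) = wedge 0 a + wedge 0 b.
Proof.
move=> a_ge0 b_ge0 ab_le.
have [->|a0] := eqVneq a 0%R.
  suff -> : wedge 0 0 = 0 by rewrite add0r add0e.
  rewrite /wedge; apply: integral0_eq => x _; apply: integral0_eq => y _.
  by rewrite /sign_differ eqxx.
have [->|b0] := eqVneq b 0%R.
  suff -> : wedge 0 0 = 0 by rewrite addr0 adde0.
  rewrite /wedge; apply: integral0_eq => x _; apply: integral0_eq => y _.
  by rewrite /sign_differ eqxx.
have a_gt0 : (0 < a)%R by rewrite lt_neqAle eq_sym a0.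
have b_gt0 : (0 < b)%R by rewrite lt_neqAle eq_sym b0.
have sina : (0 < sin a)%R.
  by rewrite sin_gt0_pi // a_gt0 /=; apply: lt_le_trans ab_le; rewrite ltrDl.
have sinb : (0 < sin b)%R.
  by rewrite sin_gt0_pi // b_gt0 /=; apply: lt_le_trans ab_le; rewrite ltrDr.
have sinab : (0 <= sin (a + b))%R by rewrite sin_ge0_pi // addr_ge0.
rewrite -[in wedge 0 b](wedge_rotation a) add0r (addrC b) /wedge.
pose K (t s : R) (z : T * T) :=
  (sign_differ (side t z.1 z.2) (side s z.1 z.2))%:E.
rewrite -(gauss_iteratedD (H := K 0%R a) (K := K a (a + b)%R));
  try exact: measurable_wedge; try exact: wedge_fun_ge0.
apply: (gauss_iterated_ae (K := fun z => K 0%R a z + K a (a + b)%R z)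
  (measurable_wedge 0 (a + b)) (wedge_fun_ge0 0 (a + b))).
- by apply: emeasurable_funD; exact: measurable_wedge.
- by move=> z; apply: adde_ge0; exact: wedge_fun_ge0.
move=> x y x0; rewrite /K /= -EFinD; congr EFin.
(* the middle direction is a nonnegative combination of the outer two *)
have mid : (sin (a + b) * side a x y = sin b * x + sin a * side (a + b) x y)%R.
  rewrite /side -(mulr1 (sin b)) -[X in (sin b * X)%R](cos2Dsin2 a).
  by rewrite sinD cosD; ring.
have -> : side 0 x y = x by rewrite /side cos0 sin0 mul1r mul0r addr0.
set p := side a x y in mid *; set q := side (a + b) x y in mid *.
rewrite /sign_differ.
case: (lerP 0 x) => hx; case: (lerP 0 p) => hp; case: (lerP 0 q) => hq;
  rewrite ?addr0 ?add0r //=; exfalso.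
  have x_gt0 : (0 < x)%R by rewrite lt_neqAle eq_sym x0.
  have : (sin (a + b) * p <= 0)%R by rewrite mulr_ge0_le0 // ltW.
  by rewrite mid leNgt ltr_pwDl ?mulr_gt0 // mulr_ge0 // ltW.
have : (0 <= sin (a + b) * p)%R by rewrite mulr_ge0.
rewrite mid leNgt -oppr_gt0 opprD -!mulrN.
by rewrite addr_gt0 // mulr_gt0 // oppr_gt0.
Qed.

(** The measure of a double wedge is additive in its opening and is 1 for the
    straight angle, hence linear. *)
Lemma wedge_angle (t : R) : (0 <= t <= pi)%R -> wedge 0 t = (t / pi)%:E.
Proof.
move=> t_itv.
have fin s : (0 <= s <= pi)%R -> wedge 0 s \is a fin_num.
  move=> /andP[s_ge0 s_le]; rewrite ge0_fin_numE ?wedge_ge0 //.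
  apply: le_lt_trans (ltry 1%R); rewrite -wedge_straight.
  rewrite -[in leRHS](subrKC s pi) wedge_additive ?subr_ge0 ?subrKC //.
  by rewrite leeDl // wedge_ge0.
rewrite -(fineK (fin _ t_itv)).
rewrite (@additive_nonneg_linear _ (fun s => fine (wedge 0 s)) pi) //.
- by rewrite wedge_straight mulr1.
- exact: pi_gt0.
- by move=> s _; apply: fine_ge0; exact: wedge_ge0.
move=> r s r_ge0 s_ge0 rs_le; rewrite wedge_additive // fineD // fin //.
  by rewrite r_ge0 (le_trans _ rs_le) // lerDl.
by rewrite s_ge0 (le_trans _ rs_le) // lerDr.
Qed.

(** Grothendieck's identity: the signs of two Gaussian linear forms differ with
    probability equal to the angle between the coefficient vectors over pi. *)
Lemma gaussian_sign_process (k : nat) :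
  exists d (S : measurableType d) (P : probability S R) (g : 'I_k -> S -> R),
    (forall i, measurable_fun [set: S] (g i)) /\
    forall u v : 'I_k -> R,
      (\sum_i u i ^+ 2 = 1)%R -> (\sum_i v i ^+ 2 = 1)%R ->
      \int[P]_t (sign_differ (\sum_i u i * g i t) (\sum_i v i * g i t))%:E
      = (acos (\sum_i u i * v i) / pi)%:E.
Proof.
have [d [S [P [g [mg gP]]]]] := gaussian_process R k.
exists d, S, P, g; split=> // u v u1 v1.
set r := (\sum_i u i * v i)%R.
have r_itv : (-1 <= r <= 1)%R.
  have := cauchy_schwarz u v; rewrite u1 v1 mulr1 -/r.
  rewrite -ler_norml -(ler_sqr (x := `|r|%R)) ?nnegrE //.
  by rewrite real_normK ?num_real // expr1n.
have acos_itv : (0 <= acos r <= pi)%R by rewrite acos_ge0 // acos_lepi.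
have cosr : cos (acos r) = r by rewrite acosK // in_itv.
rewrite -wedge_angle // /wedge.
have cosr2 : (cos (acos r) ^+ 2 + sin (acos r) ^+ 2 = 1)%R := cos2Dsin2 _.
rewrite (gP u v 1%R (cos (acos r)) (sin (acos r)) _ _ _
  (fun z => (sign_differ z.1 z.2)%:E)).
- apply: eq_integral => x _; apply: eq_integral => y _ /=.
  by rewrite /side cos0 sin0 mul0r addr0.
- by rewrite expr1n u1.
- by rewrite mul1r cosr.
- by rewrite v1.
- by apply/measurable_EFinP; exact: measurable_sign_differ.
- by move=> z; rewrite lee_fin sign_differ_ge0.
Qed.

End Wedge.

(** * Rounding to random sign matrices *)

Section Rounding.
Variable R : realType.
Local Open Scope classical_set_scope.
Local Open Scope ring_scope.

Lemma integral_finite_range d (S : measurableType d) (P : probability S R)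
    (I : finType) (pat : S -> I) (phi : I -> R) :
  (forall s, measurable (pat @^-1` [set s])) -> (forall s, 0 <= phi s) ->
  (\int[P]_t (phi (pat t))%:E)%E
  = (\sum_s phi s * fine (P (pat @^-1` [set s])))%:E.
Proof.
move=> mpat phi_ge0.
have phiE t : (phi (pat t))%:E
    = (\sum_s (phi s)%:E * (\1_(pat @^-1` [set s]) t)%:E)%E.
  rewrite (bigD1 (pat t)) //= big1 ?adde0.
    by rewrite indicE mem_set // mule1.
  move=> s st; rewrite indicE memNset ?mule0 //= => ts.
  by rewrite ts eqxx in st.
under eq_integral do rewrite phiE.
rewrite ge0_integral_sum //; first last.
- by move=> s t _; rewrite mule_ge0 // lee_fin.
- move=> s; apply: emeasurable_funM => //; apply/measurable_EFinP.
  exact: measurable_indic.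
rewrite -sumEFin; apply: eq_bigr => s _.
rewrite ge0_integralZl //; first last.
- by rewrite lee_fin.
- by apply/measurable_EFinP; exact: measurable_indic.
rewrite integral_indic // setIT EFinM fineK //.
exact: fin_num_measure.
Qed.

(** The signs of the Gaussian forms given by the rows of U and V make up a
    random rank-one sign matrix, and the matrix below is its mean. As only
    finitely many sign patterns occur, the mean is a convex combination of sign
    matrices. *)
Lemma sign_rounding n m k (U : 'M[R]_(n, k)) (V : 'M[R]_(m, k)) :
  (0 < n)%N -> (0 < m)%N ->
  (forall i, \sum_c U i c ^+ 2 = 1) -> (forall j, \sum_c V j c ^+ 2 = 1) ->
  nuclear_le (\matrix_(i, j) (1 - 2 * (acos ((U *m V^T) i j) / pi))) 1.
Proof.
move=> n_gt0 m_gt0 U1 V1.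
have [d [S [P [g [mg gP]]]]] := gaussian_sign_process R k.
pose X i t := \sum_c U i c * g c t; pose Y j t := \sum_c V j c * g c t.
pose I : finType := ({ffun 'I_n -> bool} * {ffun 'I_m -> bool})%type.
pose pat (t : S) : I := ([ffun i => 0 <= X i t], [ffun j => 0 <= Y j t]).
have mside (Z : S -> R) b : measurable_fun [set: S] Z ->
    measurable [set t | (0 <= Z t) = b].
  move=> mZ; have : measurable_fun [set: S] (fun t => 0 <= Z t).
    exact: measurable_fun_ler.
  move=> /(_ measurableT [set b]); rewrite setTI; exact.
have mX i : measurable_fun [set: S] (X i).
  by apply: measurable_sum => c; apply: measurable_funM.
have mY j : measurable_fun [set: S] (Y j).
  by apply: measurable_sum => c; apply: measurable_funM.
have mpat s : measurable (pat @^-1` [set s]).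
  have -> : pat @^-1` [set s]
      = (\bigcap_(i in [set: 'I_n]) [set t | (0 <= X i t) = s.1 i])
        `&` (\bigcap_(j in [set: 'I_m]) [set t | (0 <= Y j t) = s.2 j]).
    apply/seteqP; split=> t /=.
      by move=> <-; split=> i _ /=; rewrite ffunE.
    case: s => s1 s2 [/= h1 h2]; congr (_, _); apply/ffunP=> i; rewrite ffunE.
      exact: h1.
    exact: h2.
  by apply: measurableI; apply: fin_bigcap_measurable => // i _; exact: mside.
pose w s := fine (P (pat @^-1` [set s])).
have w_ge0 s : 0 <= w s by rewrite fine_ge0.
have w_sum : \sum_s w s = 1.
  have := integral_finite_range P (phi := fun=> 1) mpat (fun=> ler01).
  rewrite integral_cst // [X in (_ * X)%E]probability_setT mule1 => -[->].
  by apply: eq_bigr => s _; rewrite mul1r.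
have w_differ i j : \sum_(s : I) (s.1 i != s.2 j)%:R * w s
    = acos ((U *m V^T) i j) / pi.
  have := integral_finite_range P
            (phi := fun s : I => (s.1 i != s.2 j)%:R) mpat.
  move=> /(_ (fun s => ler0n _ _)).
  have := gP (U i) (V j) (U1 i) (V1 j).
  rewrite /sign_differ /= => gPij.
  under eq_integral do rewrite !ffunE.
  rewrite gPij => -[<-]; congr (acos _ / _).
  by rewrite mxE; apply: eq_bigr => c _; rewrite mxE.
pose sgn (b : bool) : R := if b then 1 else -1.
have sgn_sign b : sgn b = 1 \/ sgn b = -1 by case: b; [left|right].
have -> : \matrix_(i, j) (1 - 2 * (acos ((U *m V^T) i j) / pi))
    = \sum_(s : I) w s *: \matrix_(i, j) (sgn (s.1 i) * sgn (s.2 j)).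
  apply/matrixP=> i j; rewrite mxE summxE.
  transitivity (\sum_(s : I) (w s - 2 * ((s.1 i != s.2 j)%:R * w s))).
    by rewrite sumrB w_sum -mulr_sumr w_differ.
  apply: eq_bigr => s _; rewrite !mxE /sgn.
  by case: (s.1 i); case: (s.2 j); rewrite /= ?mulr1n ?mulr0n; ring.
rewrite -w_sum; apply: nuclear_le_sum => s.
rewrite -[X in nuclear_le _ X]mulr1 -[X in X * 1]ger0_norm //.
by apply/nuclear_leZ/nuclear_le_sign/sign_rank1_outer.
Qed.

End Rounding.

(** * Krivine's bound for the Grothendieck constant *)

Section Krivine.
Variable R : realType.
Local Open Scope classical_set_scope.
Local Open Scope ring_scope.

(** Pad the rows of U and of V to unit length in two separate new coordinates,
    which leaves the inner products unchanged. *)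
Lemma gamma2_le_unit n m (X : 'M[R]_(n, m)) :
  gamma2_le X 1 -> exists k (U : 'M[R]_(n, k)) (V : 'M[R]_(m, k)),
    [/\ X = U *m V^T, forall i, \sum_c U i c ^+ 2 = 1
      & forall j, \sum_c V j c ^+ 2 = 1].
Proof.
move=> [k [U [V [-> U1 V1]]]].
pose pad p (A : 'M[R]_(p, k)) : 'cV[R]_p :=
  \col_i Num.sqrt (1 - \sum_c A i c ^+ 2).
exists (k + (1 + 1))%N, (row_mx U (row_mx (pad _ U) 0)),
  (row_mx V (row_mx 0 (pad _ V))).
have padE p (A : 'M[R]_(p, k)) i : \sum_c A i c ^+ 2 <= 1 ->
    pad _ A i 0 ^+ 2 = 1 - \sum_c A i c ^+ 2.
  by move=> A1; rewrite mxE sqr_sqrtr // subr_ge0.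
have pad_sum p (A : 'M[R]_(p, k)) (B C : 'cV[R]_p) i :
    \sum_c (row_mx A (row_mx B C) : 'M[R]_(p, k + (1 + 1))) i c ^+ 2
    = \sum_c A i c ^+ 2 + (B i 0 ^+ 2 + C i 0 ^+ 2).
  rewrite big_split_ord; congr (_ + _).
    by apply: eq_bigr => j _; rewrite row_mxEl.
  under eq_bigr do rewrite row_mxEr.
  by rewrite big_split_ord; congr (_ + _);
    rewrite big_ord1 ?row_mxEl ?row_mxEr [ord0]ord1.
split.
- by rewrite !tr_row_mx !mul_row_col trmx0 mulmx0 mul0mx !addr0.
- move=> i; rewrite pad_sum padE // mxE expr0n addr0 subrKC //.
- move=> i; rewrite pad_sum padE // mxE expr0n add0r subrKC //.
Qed.

Let fact1 : 1`!%:R = 1 :> R. Proof. by []. Qed.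
Let fact2 : 2`!%:R = 2 :> R. Proof. by []. Qed.
Let fact3 : 3`!%:R = 6 :> R. Proof. by []. Qed.
Let fact4 : 4`!%:R = 24 :> R. Proof. by []. Qed.
Let fact5 : 5`!%:R = 120 :> R. Proof. by []. Qed.
Let fact6 : 6`!%:R = 720 :> R. Proof. by []. Qed.
Let fact7 : 7`!%:R = 7 * 720 :> R.
Proof. by rewrite (factS 6) natrM fact6. Qed.
Let fact8 : 8`!%:R = 56 * 720 :> R.
Proof. by rewrite (factS 7) natrM fact7; ring. Qed.
Let fact9 : 9`!%:R = 504 * 720 :> R.
Proof. by rewrite (factS 8) natrM fact8; ring. Qed.

(** Krivine's constant is pi / (2 c) for the c with sinh c = 1. This rational
    number is slightly smaller than that c, which leaves room for the tail of
    the sine series and still gives pi / (2 c) < 713 / 400. *)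
Let c : R := 52 / 59.

Let c_gt0 : 0 < c. Proof. by rewrite /c; lra. Qed.

(** The partial sums of the series of sinh c. Each term is at most half the
    previous one, so twice the first omitted term dominates the tail, and four
    terms give the bound. *)
Lemma sinh_partial_le1 K : \sum_(k < K) c ^+ k.*2.+1 / k.*2.+1`!%:R <= 1.
Proof.
pose t k := c ^+ k.*2.+1 / k.*2.+1`!%:R.
have t_ge0 k : 0 <= t k by rewrite divr_ge0 // exprn_ge0 // ltW.
have t_half k : t k.+1 <= t k / 2.
  have -> : t k.+1 = t k * (c ^+ 2 / (k.*2.+3 * k.*2.+2)%:R).
    rewrite /t doubleS (_ : k.*2.+3`! = k.*2.+1`! * (k.*2.+3 * k.*2.+2))%N.
      by rewrite natrM invfM [RHS]mulrACA -exprD addn2.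
    by rewrite 2!factS mulnA mulnC.
  rewrite ler_wpM2l // ler_pdivrMr ?ltr0n ?muln_gt0 //.
  apply: (@le_trans _ _ 1); first by rewrite /c; lra.
  have : (2 : R) <= (k.*2.+3 * k.*2.+2)%:R by rewrite ler_nat !mulSn; lia.
  by lra.
have tail j : \sum_(k < 4 + j) t k + 2 * t (4 + j)%N <= 1.
  elim: j => [|j IHj].
    rewrite addn0 !big_ord_recr big_ord0 /= /t /=.
    rewrite fact1 invr1 fact3 fact5 fact7 fact9 (invfM 7) (invfM 504) /c.
    by lra.
  rewrite addnS big_ord_recr /=; have := t_half (4 + j)%N.
  by move: IHj; lra.
have mono j : \sum_(k < K) t k <= \sum_(k < j + K) t k.
  rewrite addnC big_split_ord /= lerDl; exact: sumr_ge0.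
apply: le_trans (mono 4%N) _; apply: le_trans (tail K).
by rewrite lerDl mulr_ge0.
Qed.

(** cos 1.571 < 0, by the alternating series of the cosine stopped after the
    eighth power. *)
Lemma pi_le : pi <= 3142 / 1000 :> R.
Proof.
pose x : R := 1571 / 1000.
have cosx : cos x < 0.
  rewrite -oppr_gt0.
  have h : series (fun n => - cos_coeff' x n) @ \oo --> - cos x.
    have -> : series (fun n => - cos_coeff' x n)
        = (fun n => - series (cos_coeff' x) n).
      by apply/funext => n; rewrite /series /= sumrN.
    by apply: cvgN; exact: cvg_cos_coeff'.
  rewrite -(cvg_lim (@Rhausdorff R) h).
  apply: (@lt_trans _ _ (\sum_(0 <= i < 5) - cos_coeff' x i)).
    rewrite !big_nat_recr //= big_nil /cos_coeff' /=.
    rewrite -!exprnP fact0 fact2 fact4 fact6 fact8 (invfM 56) /x.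
    by lra.
  apply: lt_sum_lim_series => [|d]; first by move/cvgP in h.
  pose N := (5 + d.*2).*2.
  have cc k : cos_coeff' x k = (-1) ^+ k * (x ^+ k.*2 / k.*2`!%:R).
    by rewrite /cos_coeff' -exprnP mulrA.
  have -> : (5 + d.*2.+1 = (5 + d.*2).+1)%N by rewrite addnS.
  have odd_sign : (-1) ^+ (5 + d.*2) = -1 :> R.
    by rewrite -signr_odd oddD odd_double expr1.
  rewrite !cc (exprS _ (5 + d.*2)) odd_sign doubleS -/N.
  rewrite !mulN1r !opprK mul1r subr_gt0.
  have NE : (N.+2`! = N`! * (N.+2 * N.+1))%N by rewrite 2!factS mulnA mulnC.
  rewrite NE natrM invfM -[N.+2]addn2 exprD mulrACA.
  have x_gt0 : 0 < x by rewrite /x; lra.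
  rewrite gtr_pMr ?divr_gt0 ?exprn_gt0 ?ltr0n ?fact_gt0 //.
  rewrite ltr_pdivrMr ?ltr0n ?muln_gt0 ?addn2 // mul1r.
  apply: (@lt_le_trans _ _ 4); first by rewrite /x; lra.
  by rewrite ler_nat /N; lia.
have x_gt : pi / 2 < x.
  rewrite ltNge; apply/negP => x_le.
  have : 0 <= cos x.
    apply: cos_ge0_pihalf; rewrite x_le andbT.
    by have := pi_ge0 R; rewrite /x; lra.
  by rewrite leNgt cosx.
by move: x_gt; rewrite /x; lra.
Qed.

(** Krivine's trick: applying a power series entrywise to X costs at most the
    sum of the absolute values of its coefficients. For the sine of c X that sum
    is sinh c. Truncating the series keeps all factorizations finite. *)
Lemma gamma2_le_sine n m (X : 'M[R]_(n, m)) K : gamma2_le X 1 ->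
  gamma2_le (\matrix_(i, j) series (sin_coeff' (c * X i j)) K) 1.
Proof.
move=> X1; apply: gamma2_le_weaken (sinh_partial_le1 K) _.
have -> : \matrix_(i, j) series (sin_coeff' (c * X i j)) K
    = \sum_(k < K) ((-1) ^+ k * (c ^+ k.*2.+1 / k.*2.+1`!%:R))
        *: \matrix_(i, j) X i j ^+ k.*2.+1.
  apply/matrixP=> i j; rewrite mxE summxE /series /= big_mkord.
  apply: eq_bigr => k _; rewrite !mxE /sin_coeff' -exprnP exprMn.
  by rewrite -!mulrA; congr (_ * (_ * _)); rewrite mulrC.
elim: K => [|K IHK]; first by rewrite !big_ord0; exact: gamma2_le0.
rewrite !big_ord_recr /=; apply: gamma2_leD IHK _.
have := gamma2_leZ ((-1) ^+ K * (c ^+ K.*2.+1 / K.*2.+1`!%:R))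
          (gamma2_le_pow K.*2.+1 X1).
rewrite normrM normrX normrN1 expr1n mul1r mulr1 ger0_norm //.
by rewrite divr_ge0 // exprn_ge0 // ltW.
Qed.

(** Rounding produces 1 - (2 / pi) acos z = (2 / pi) asin z, which the sine
    inverts: in the limit the rounded entries are linear in t. *)
Lemma sine_angle_cvg (t : R) : `|t| <= 1 ->
  (fun K => 1 - 2 * (acos (series (sin_coeff' (c * t)) K) / pi)) @ \oo
    --> 2 * c / pi * t.
Proof.
move=> t1; have pi_neq0 : pi != 0 :> R by rewrite gt_eqF // pi_gt0.
have ct : `|c * t| < pi / 2.
  rewrite normrM (gtr0_norm c_gt0); apply: (@le_lt_trans _ _ (c * 1)).
    by rewrite ler_wpM2l // ltW.
  by have := pihalf_ge1 R; rewrite /c; lra.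
have /andP[ct_gt ct_lt] : - (pi / 2) < c * t < pi / 2 by rewrite -ltr_norml.
have acosE : acos (sin (c * t)) = pi / 2 - c * t.
  have -> : sin (c * t) = cos (pi / 2 - c * t).
    by rewrite -cosBpihalf -cosN opprB.
  by rewrite cosK // in_itv /=; apply/andP; split; lra.
have -> : 2 * c / pi * t = 1 - 2 * (acos (sin (c * t)) / pi).
  by rewrite acosE; move: pi pi_neq0 => p p_neq0; field.
apply: (@cvgB _ R^o); first exact: cvg_cst.
apply: cvgMl_tmp; apply: cvgMr_tmp.
apply: continuous_cvg (@cvg_sin_coeff' R (c * t)).
have pi0 := pi_ge0 R.
have lo_in : - (pi / 2) \in `[- (pi / 2), pi / 2 : R].
  by rewrite in_itv /=; apply/andP; split; lra.
have hi_in : pi / 2 \in `[- (pi / 2), pi / 2 : R].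
  by rewrite in_itv /=; apply/andP; split; lra.
have ct_in : c * t \in `[- (pi / 2), pi / 2 : R].
  by rewrite in_itv /=; apply/andP; split; lra.
apply: continuous_acos; apply/andP; split.
  by rewrite -[X in - X < _](sin_pihalf R) -sinN (ltr_sin lo_in ct_in).
by rewrite -[X in _ < X](sin_pihalf R) (ltr_sin ct_in hi_in).
Qed.

(** Rounding the truncated sine of c X gives a convex combination M K of sign
    matrices that tends to (2 c / pi) X; the error has small entries, hence a
    small sign nuclear norm. *)
Lemma krivine_nuclear_le n m (X : 'M[R]_(n, m)) g :
  gamma2_le X 1 -> pi / (2 * c) < g -> nuclear_le X g.
Proof.
move=> X1 g_gt; have pi_pos : 0 < pi :> R := pi_gt0 R.
have scale_gt0 : 0 < pi / (2 * c) by rewrite divr_gt0 // mulr_gt0.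
have empty_le : X = 0 -> nuclear_le X g.
  move=> ->; apply: nuclear_le_weaken (nuclear_le0 _ _ _).
  by rewrite ltW // (lt_trans _ g_gt).
have [n0|n_gt0] := posnP n.
  by apply: empty_le; apply/matrixP=> i; have := ltn_ord i; rewrite {2}n0.
have [m0|m_gt0] := posnP m.
  by apply: empty_le; apply/matrixP=> i j; have := ltn_ord j; rewrite {2}m0.
pose M K : 'M[R]_(n, m) := \matrix_(i, j)
  (1 - 2 * (acos (series (sin_coeff' (c * X i j)) K) / pi)).
have M1 K : nuclear_le (M K) 1.
  have [k [U [V [XE U1 V1]]]] := gamma2_le_unit (gamma2_le_sine K X1).
  have := sign_rounding n_gt0 m_gt0 U1 V1; rewrite -XE; congr nuclear_le.
  by apply/matrixP=> i j; rewrite !mxE.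
pose err K := \sum_i \sum_j `|2 * c / pi * X i j - M K i j|.
have err_cvg : err @ \oo --> 0.
  have -> : 0 = \sum_(i < n) \sum_(j < m) (0 : R).
    by rewrite big1 // => i _; rewrite big1.
  apply: cvg_big => [|i _]; first exact: add_continuous.
  apply: cvg_big => [|j _]; first exact: add_continuous.
  rewrite -[X in _ --> X](normr0 R) -(subrr (2 * c / pi * X i j)).
  apply: cvg_norm; apply: cvgB; first exact: cvg_cst.
  under eq_fun do rewrite mxE.
  by apply: sine_angle_cvg; exact: gamma2_le_entry X1.
have bound K : nuclear_le X (pi / (2 * c) * (1 + err K)).
  rewrite -[X in X * (1 + _)]ger0_norm ?(ltW scale_gt0) //.
  have -> : X = (pi / (2 * c)) *: (M K + ((2 * c / pi) *: X - M K)).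
    rewrite subrKC scalerA (_ : _ * _ = 1) ?scale1r //.
    by move: pi pi_pos => p p_pos; field; rewrite !gt_eqF.
  apply/nuclear_leZ/nuclear_leD => //.
  have := nuclear_le_entries (2 * c / pi *: X - M K) n_gt0 m_gt0.
  congr nuclear_le; apply: eq_bigr => i _; apply: eq_bigr => j _.
  by rewrite !mxE.
have bound_cvg : (fun K => pi / (2 * c) * (1 + err K)) @ \oo
    --> pi / (2 * c) * (1 + 0).
  by apply: cvgMl_tmp; apply: (@cvgD _ R^o) err_cvg; exact: cvg_cst.
rewrite addr0 mulr1 in bound_cvg.
have near_g : \forall K \near \oo, pi / (2 * c) * (1 + err K) < g.
  exact: cvgr_lt bound_cvg _ g_gt.
have [K /ltW Kg] := filter_ex near_g.
exact: nuclear_le_weaken Kg (bound K).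
Qed.

Lemma sign_nuclear_le_gamma2 n m (X : 'M[R]_(n, m)) :
  sign_nuclear X <= 713 / 400 * gamma2 X.
Proof.
have pi_c : pi / (2 * c) < 713 / 400.
  rewrite ltr_pdivrMr ?mulr_gt0 //.
  by have := pi_le; rewrite /c; lra.
rewrite mulrC -ler_pdivrMr; last by lra.
apply/ler_addgt0Pr => e e_gt0; rewrite ler_pdivrMr; last by lra.
set s := gamma2 X + e; have s_gt : gamma2 X < s by rewrite ltrDl.
have s_gt0 : 0 < s := le_lt_trans (gamma2_ge0 X) s_gt.
have X1 : gamma2_le (s^-1 *: X) 1.
  have := gamma2_leZ s^-1 (gamma2_lt_gamma2_le s_gt).
  by rewrite ger0_norm ?invr_ge0 ?(ltW s_gt0) // mulVf // gt_eqF.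
apply: sign_nuclear_ub.
have := nuclear_leZ s (krivine_nuclear_le X1 pi_c).
by rewrite scalerA divff ?gt_eqF // scale1r gtr0_norm.
Qed.

End Krivine.

(** * The completion error *)

Section Grothendieck.
Variable R : realType.
Local Notation KG := (grothendieck R).

Let constants : set R := [set K : R | forall n m (X : 'M[R]_(n, m)),
                            sign_nuclear X <= K * gamma2 X]%classic.

Let constants_ex : constants (713 / 400).
Proof. exact: sign_nuclear_le_gamma2. Qed.

(** Tested on the 1 x 1 matrix 1, where gamma_2 is positive. *)
Let constants_lb : lbound constants 0.
Proof.
move=> K /(_ 1%N 1%N (const_mx 1)); set X := const_mx 1 => XK.
have X_ge1 : 1 <= gamma2 X.
  rewrite leNgt; apply/negP => X_lt1.
  have X_mid : gamma2 X < (gamma2 X + 1) / 2 by lra.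
  have := gamma2_le_entry 0 0 (gamma2_lt_gamma2_le X_mid).
  by rewrite mxE normr1; lra.
have := le_trans (sign_nuclear_ge0 X) XK.
by rewrite pmulr_lge0 // (lt_le_trans _ X_ge1).
Qed.

Lemma grothendieck_ge0 : 0 <= KG.
Proof. by apply: lb_le_inf constants_lb; exists (713 / 400). Qed.

Lemma grothendieck_le : KG <= 713 / 400.
Proof.
by apply: ge_inf; [exists 0; exact: constants_lb | exact: constants_ex].
Qed.

(** The infimum that defines the constant is attained. *)
Lemma grothendieck_spec n m (X : 'M[R]_(n, m)) :
  sign_nuclear X <= KG * gamma2 X.
Proof.
have [X0|X0] := eqVneq (gamma2 X) 0.
  by have := sign_nuclear_le_gamma2 X; rewrite X0 !mulr0.
have X_gt0 : 0 < gamma2 X by rewrite lt_neqAle eq_sym X0 gamma2_ge0.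
rewrite -ler_pdivrMr //; apply: lb_le_inf; first by exists (713 / 400).
by move=> K XK; rewrite ler_pdivrMr.
Qed.

End Grothendieck.

(** The triangle inequality gives gamma_2 (X - Y) <= 2 gamma_2 Y, and Schur
    products square it. As gamma_2 is an infimum, both are applied with a bound
    s slightly above gamma_2 Y. *)
Lemma gamma2_sqr_diff_le (R : realType) n m (X Y : 'M[R]_(n, m)) :
  gamma2 X <= gamma2 Y ->
  gamma2 (\matrix_(i, j) ((X - Y) i j * (X - Y) i j)) <= 4 * gamma2 Y ^+ 2.
Proof.
move=> XY; set W := \matrix_(i, j) _; set g := gamma2 Y.
have g_ge0 : 0 <= g := gamma2_ge0 Y.
have W_le s : g < s -> gamma2 W <= 4 * s ^+ 2.
  move=> gs; have s_ge0 : 0 <= s := le_trans g_ge0 (ltW gs).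
  have Xs := gamma2_lt_gamma2_le (le_lt_trans XY gs).
  have Ys := gamma2_leZ (-1) (gamma2_lt_gamma2_le gs).
  have := gamma2_leD Xs Ys; rewrite normrN1 mul1r scaleN1r => Zs.
  have := gamma2_le_hadamard Zs Zs.
  rewrite (_ : _ * _ = 4 * s ^+ 2); last by ring.
  by apply: gamma2_ub; rewrite mulr_ge0 // sqr_ge0.
rewrite leNgt; apply/negP => W_gt.
pose t := Num.sqrt (gamma2 W) / 2.
have tE : gamma2 W = 4 * t ^+ 2.
  rewrite /t expr_div_n sqr_sqrtr; last exact: gamma2_ge0.
  by field.
have t_ge0 : 0 <= t by rewrite divr_ge0 // sqrtr_ge0.
have g_lt_t : g < t.
  by rewrite -ltr_sqr ?nnegrE //; move: W_gt; rewrite tE; lra.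
have := W_le ((g + t) / 2); rewrite tE => /(_ _)/negPn.
have mid : g < (g + t) / 2 by lra.
move=> /(_ mid); apply/negP; rewrite negbK -ltNge.
rewrite ltr_pM2l // ltr_sqr ?nnegrE //; lra.
Qed.

Theorem theorem24 (R : realType) (n m d1 d2 : nat) (E : {set 'I_n * 'I_m})
    (lambda2 eta : R) (Y Yhat : 'M[R]_(n, m))
    (n_gt0 : (0 < n)%N) (m_gt0 : (0 < m)%N)
    (d1_gt0 : (0 < d1)%N) (d2_gt0 : (0 < d2)%N)
    (E_biregular : biregular d1 d2 E)
    (lambda2_second : second_largest_eigenvalue (adjmx R E) lambda2)
    (lambda2_le : lambda2 <= eta) (eta_ge0 : 0 <= eta)
    (Yhat_sol : gamma2_completion E Y Yhat) :
  let c : R := 4 * grothendieck R in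
  (n * m)%:R^-1 * frobenius (Yhat - Y) ^+ 2
    <= c * gamma2 Y ^+ 2 * (eta / Num.sqrt (d1 * d2)%:R)
  /\ c <= 713 / 100.
Proof.
move=> c; split; last by rewrite /c; have := grothendieck_le R; lra.
have [agree Yhat_min] := Yhat_sol.
set q := eta / Num.sqrt (d1 * d2)%:R.
have q_ge0 : 0 <= q by rewrite divr_ge0 // sqrtr_ge0.
pose W := \matrix_(i, j) ((Yhat - Y) i j * (Yhat - Y) i j).
(* w pairs with a matrix to its mean over all entries minus its mean over E *)
pose w : 'M[R]_(n, m) :=
  \matrix_(i, j) ((n * m)%:R^-1 - (n * d1)%:R^-1 * ((i, j) \in E)%:R).
have w_sign S : sign_rank1 S -> \sum_i \sum_j w i j * S i j <= q.
  move=> /sign_rank1_factor[a [b [a_sign b_sign Sab]]].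
  have Na_sign i : (- a) 0 i ^+ 2 = 1 by rewrite mxE sqrrN.
  have := sign_mixing E_biregular d1_gt0 d2_gt0 n_gt0 m_gt0 lambda2_second
            lambda2_le eta_ge0 Na_sign b_sign.
  congr (_ <= _); rewrite !mulr_sumr -sumrB; apply: eq_bigr => i _.
  rewrite !mulr_sumr -sumrB; apply: eq_bigr => j _.
  by rewrite Sab !mxE; ring.
have w_W : \sum_i \sum_j w i j * W i j
           = (n * m)%:R^-1 * frobenius (Yhat - Y) ^+ 2.
  rewrite sqr_sqrtr; last first.
    by apply: sumr_ge0 => i _; apply: sumr_ge0 => j _; rewrite sqr_ge0.
  rewrite mulr_sumr; apply: eq_bigr => i _; rewrite mulr_sumr.
  apply: eq_bigr => j _; rewrite !mxE; have [ijE|_] := boolP ((i, j) \in E).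
    by rewrite (agree _ _ ijE) subrr; ring.
  by rewrite mulr0 subr0 expr2.
rewrite -w_W; apply: le_trans (sign_nuclear_dual W n_gt0 m_gt0 q_ge0 w_sign) _.
rewrite mulrC ler_wpM2r // /c -mulrA mulrCA.
apply: le_trans (grothendieck_spec W) _.
apply: ler_wpM2l (grothendieck_ge0 R) _ _ _.
by apply: gamma2_sqr_diff_le; apply: Yhat_min.
Qed.
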